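(* Let $n\ge 3$, let $T$ be an arbitrary triangulation of a convex $n$-gon, and let $Q=Q_T$ be the (reduced) quiver of the GL$_2$-dimer of $T$, with dimer algebra $\Lambda_Q$ and boundary algebra $\mathcal B_Q=e_b\Lambda_Qe_b$. Then $$\mathcal B_Q\;\cong\;\mathbb{C}\Gamma(n)/I,$$ where $I$ is the ideal generated by the relations, for $i=1,\dots,n$ (indices modulo $2n$), $$x_{2i+1}x_{2i+2}z_{2i+2}=z_{2i}x_{2i-1}x_{2i},\qquad z_{2i}z_{2i-2}=x_{2i+1}x_{2i+2}\cdots x_{2i+2(n-2)}$$ (the right-hand side of the second relation is the path of $2n-4$ consecutive arrows $x$ from $2i$ to $2i-4$), and the isomorphism sends each $x_k$ to the boundary arrow $k-1\to k$ of $Q$. Moreover the element $$t:=\sum_{i=1}^{n}x_{2i-1}x_{2i}z_{2i}+\sum_{i=1}^{n}x_{2i}z_{2i}x_{2i-1}$$ is central in $\mathcal B_Q$.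
   Context: Paths are composed from left to right: for arrows $a:i\to j$, $b:j\to k$, $ab$ denotes the path $i\to j\to k$. A dimer model with boundary is a finite quiver without loops together with a set of faces $Q_2=Q_2^+\sqcup Q_2^-$, each face having an oriented cycle as its boundary, such that every arrow lies in exactly one face (boundary arrow) or exactly two faces (internal arrow), each internal arrow lying in one face of $Q_2^+$ and one of $Q_2^-$, and the incidence graph at each vertex is connected. Its dimer algebra is $\Lambda_Q=\mathbb{C}Q/\langle\partial W\rangle$, where $W=\sum_{F\in Q_2^+}\partial F-\sum_{F\in Q_2^-}\partial F$ and $\partial W$ consists of the relations $p_1\cdots p_k=q_1\cdots q_l$, one for each internal arrow $\alpha$ lying on the positive face boundary $\alpha p_1\cdots p_k$ and the negative face boundary $\alpha q_1\cdots q_l$. Boundary vertices are those incident with a boundary arrow; $e_b$ is the sum of the trivial paths at the boundary vertices, and the boundary algebra is $\mathcal B_Q=e_b\Lambda_Qe_b$. GL$_m$-dimer and its quiver: let $m\ge2$, $n\ge 3$, and let $T$ be a triangulation of a convex $n$-gon $P$ with vertices $v_1,\dots,v_n$ in anticlockwise order. Subdivide every triangle of $T$ by $m-1$ equidistant lines parallel to each of its sides into $m^2$ small triangles (upward ones, i.e. translates of the big triangle, and downward ones). Put a black node at the midpoint of each of the $m$ segments into which each side of each triangle (edge of $P$ or diagonal of $T$) is cut, a black node in every downward small triangle, and a white node in every upward small triangle. Join two nodes of different colour if they belong to the same small triangle or their small triangles share a side. This bipartite graph $G$ is the GL$_m$-dimer of $T$. Its quiver has one vertex for each connected component of $P\setminus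 G$ and, for each edge of $G$, one arrow between the two components it separates, oriented so that the white endpoint lies to its left; each white node gives an anticlockwise face (in $Q_2^+$) and each black node of degree $\ge2$ a clockwise face (in $Q_2^-$). This is a dimer model with boundary. Every 2-cycle of internal arrows is removed using the relations from the potential (on $G$: a bivalent black node is deleted and its two white neighbours are merged); $Q_T$ denotes the resulting reduced quiver and $\Lambda_{Q_T}$ its dimer algebra. $Q_T$ has $mn$ boundary vertices, labelled $1,\dots,mn$ anticlockwise so that vertex $(j-1)m+1$ is the component at the corner $v_j$ (and $(j-1)m+2,\dots,jm$ are the components meeting the interior of the edge $v_jv_{j+1}$); the boundary arrows are $x_k:k-1\to k$, indices modulo $mn$. The quiver $\Gamma(n)$: vertices $1,\dots,2n$; arrows $x_k:k-1\to k$ for $k=1,\dots,2n$ and $z_{2k}:2k\to 2k-2$ for $k=1,\dots,n$ (indices modulo $2n$, taken in $[1,2n]$). *)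

(* Defs.v *)
From HB Require Import structures.
From mathcomp Require Import all_boot all_order all_algebra.
Set Implicit Arguments. Unset Strict Implicit. Unset Printing Implicit Defensive.
Import GRing.Theory.

(* A quiver has vertices 0 .. qnv-1 and arrows 0 .. size qarr - 1;    *)
(* arrow a goes from (qarr`_a).1 to (qarr`_a).2.                        *)
Record quiver := Quiver { qnv : nat; qarr : seq (nat * nat) }.

Definition src (Q : quiver) (a : nat) : nat := (nth (0, 0) (qarr Q) a).1.
Definition tgt (Q : quiver) (a : nat) : nat := (nth (0, 0) (qarr Q) a).2.

(* a path = (start vertex, list of arrows), composed left to right *)
Definition qpath := (nat * seq nat)%type.

Definition pend (Q : quiver) (p : qpath) : nat := last p.1 (map (tgt Q) p.2).

Fixpoint chain (Q : quiver) (v : nat) (l : seq nat) : bool :=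
  match l with
  | [::] => true
  | a :: l' => [&& a < size (qarr Q), src Q a == v & chain Q (tgt Q a) l']
  end.

Definition pvalid (Q : quiver) (p : qpath) : bool := (p.1 < qnv Q) && chain Q p.1 p.2.

Definition apath (Q : quiver) (l : seq nat) : qpath := (src Q (head 0 l), l).

(* elements of the path algebra K Q : finite formal linear combinations
   of paths; non-valid "paths" are identified with 0 (see [coef]). *)
Definition lc (K : Type) := seq (K * qpath).

Section LC.
Variable K : numClosedFieldType.

Definition coef (Q : quiver) (f : lc K) (p : qpath) : K :=
  if pvalid Q p then (\sum_(c <- f | c.2 == p) c.1)%R else 0%R.

Definition lc_eq (Q : quiver) (f g : lc K) : Prop := forall p, coef Q f p = coef Q g p.

Definition lc_scale (k : K) (f : lc K) : lc K := [seq ((k * c.1)%R, c.2) | c <- f].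

Definition lc_mul (Q : quiver) (f g : lc K) : lc K :=
  flatten [seq [seq ((c.1 * d.1)%R, (c.2.1, c.2.2 ++ d.2.2)) | d <- g & pend Q c.2 == d.2.1]
          | c <- f].

Definition in_ideal (Q : quiver) (R : seq (lc K)) (f : lc K) : Prop :=
  exists ts : seq (K * qpath * nat * qpath),
    lc_eq Q f (flatten [seq lc_scale t.1.1.1
                          (lc_mul Q (lc_mul Q [:: (1%R, t.1.1.2)] (nth [::] R t.1.2))
                                    [:: (1%R, t.2)]) | t <- ts]).

Definition cong (Q : quiver) (R : seq (lc K)) (f g : lc K) : Prop :=
  in_ideal Q R (f ++ lc_scale (-1)%R g).

Definition rel (s : nat) (p q : seq nat) : lc K := [:: (1%R, (s, p)); ((-1)%R, (s, q))].

End LC.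

Record dimer := Dimer { dq : quiver; dpos : seq (seq nat); dneg : seq (seq nat) }.

(* for a face boundary F (cyclic list of arrows) containing a,
   the path following a around F, i.e. F = a p_1 ... p_k |-> p_1 ... p_k *)
Definition rest (F : seq nat) (a : nat) : seq nat :=
  let i := index a F in drop i.+1 F ++ take i F.

(* the relations dW : p_1..p_k = q_1..q_l for each internal arrow a
   lying on the positive face a p_1..p_k and on the negative face a q_1..q_l *)
Definition dimer_rels (K : numClosedFieldType) (D : dimer) : seq (lc K) :=
  flatten [seq flatten [seq [seq rel K (tgt (dq D) a) (rest F a) (rest G a)
                             | G <- dneg D & a \in G]
                        | F <- dpos D & a \in F]
          | a <- iota 0 (size (qarr (dq D)))].

Definition nfaces (D : dimer) (a : nat) : nat := count (fun F => a \in F) (dpos D ++ dneg D).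

Definition is_bvertex (D : dimer) (v : nat) : bool :=
  has (fun a => (nfaces D a == 1) && ((src (dq D) a == v) || (tgt (dq D) a == v)))
      (iota 0 (size (qarr (dq D)))).

Definition eb (K : numClosedFieldType) (D : dimer) : lc K :=
  [seq (1%R, (v, [::])) | v <- iota 0 (qnv (dq D)) & is_bvertex D v].

(* Triangulations of a convex n-gon with vertices 0,...,n-1             *)
(* (vertex v_j of the paper is 0-based j-1), anticlockwise.             *)
Definition is_diag (n : nat) (d : nat * nat) : bool :=
  [&& d.1 < d.2, d.2 < n, 1 < d.2 - d.1 & ~~ ((d.1 == 0) && (d.2 == n.-1))].

Definition cross (d e : nat * nat) : bool :=
  ((d.1 < e.1 < d.2) && (d.2 < e.2)) || ((e.1 < d.1 < e.2) && (e.2 < d.2)).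

Definition triangulation (n : nat) (T : seq (nat * nat)) : Prop :=
  [/\ uniq T, all (is_diag n) T,
      {in T &, forall d e, ~~ cross d e} &
      forall d, is_diag n d -> d \notin T -> has (cross d) T].

Definition is_edge (n i j : nat) : bool := (j == i.+1) || ((i == 0) && (j == n.-1)).

Definition side (n : nat) (T : seq (nat * nat)) (i j : nat) : bool :=
  is_edge n i j || ((i, j) \in T).

Definition triples (n : nat) : seq (nat * nat * nat) :=
  flatten [seq flatten [seq [seq (i, j, k) | k <- iota 0 n] | j <- iota 0 n] | i <- iota 0 n].

Definition triangles (n : nat) (T : seq (nat * nat)) : seq (nat * nat * nat) :=
  [seq t <- triples n | let: (i, j, k) := t in
     [&& i < j, j < k, side n T i j, side n T j k & side n T i k]].

(* The reduced quiver Q_T of the GL_2-dimer of T (m = 2).               *)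
(* Vertices: boundary vertex with paper label k (1..2n) is k-1;        *)
(*   so the corner at v_{p+1} is 2p and the component at the middle of  *)
(*   the edge v_{p+1} v_{p+2} is 2p+1; the component at the middle of   *)
(*   the diagonal T`_q is 2n+q.                                         *)
(* Arrows: boundary arrow x_k (k = 1..2n) is arrow k-1, from label k-1  *)
(*   to label k; then for each triangle (i,j,k) the three arrows of the *)
(*   clockwise cycle around its central black node:                      *)
(*   mid(ij)->mid(ik), mid(ik)->mid(jk), mid(jk)->mid(ij).               *)
Definition lab (n k : nat) : nat := (k + 2 * n - 1) %% (2 * n).

Definition mid (n : nat) (T : seq (nat * nat)) (i j : nat) : nat :=
  if j == i.+1 then 2 * i + 1
  else if (i == 0) && (j == n.-1) then 2 * n - 1
  else 2 * n + index (i, j) T.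

Definition bnd_arrows (n : nat) : seq (nat * nat) :=
  [seq (lab n (k + 2 * n - 1), lab n k) | k <- iota 1 (2 * n)].

Definition tri_arrows (n : nat) (T : seq (nat * nat)) : seq (nat * nat) :=
  flatten [seq let: (i, j, k) := t in
             [:: (mid n T i j, mid n T i k); (mid n T i k, mid n T j k);
                 (mid n T j k, mid n T i j)]
          | t <- triangles n T].

Definition QT (n : nat) (T : seq (nat * nat)) : quiver :=
  Quiver (2 * n + size T) (bnd_arrows n ++ tri_arrows n T).

(* the corner (white upward small triangle) to which each triangle arrow belongs *)
Definition tri_corners (n : nat) (T : seq (nat * nat)) : seq nat :=
  flatten [seq let: (i, j, k) := t in [:: i; k; j] | t <- triangles n T].

(* arrows of the (merged) white face at the corner v_{p+1} *)
Definition corner_arrows (n : nat) (T : seq (nat * nat)) (p : nat) : seq nat :=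
  (2 * p + 1) :: (2 * p)
    :: [seq 2 * n + q | q <- iota 0 (size (tri_corners n T)) & nth 0 (tri_corners n T) q == p].

(* arranging a set of arrows forming a cycle as the cyclic boundary path *)
Fixpoint walk (Q : quiver) (S : seq nat) (a : nat) (fuel : nat) : seq nat :=
  match fuel with
  | 0 => [::]
  | f.+1 => a :: walk Q S (nth a S (find (fun b => src Q b == tgt Q a) S)) f
  end.

Definition pos_faces (n : nat) (T : seq (nat * nat)) : seq (seq nat) :=
  [seq walk (QT n T) (corner_arrows n T p) (2 * p + 1) (size (corner_arrows n T p))
  | p <- iota 0 n].

Definition neg_faces (n : nat) (T : seq (nat * nat)) : seq (seq nat) :=
  [seq [:: 2 * n + 3 * q; 2 * n + 3 * q + 1; 2 * n + 3 * q + 2]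
  | q <- iota 0 (size (triangles n T))].

Definition DT (n : nat) (T : seq (nat * nat)) : dimer := Dimer (QT n T) (pos_faces n T) (neg_faces n T).

(* The quiver Gamma(n): vertex with label k (1..2n) is k-1;             *)
(* arrow x_k (k=1..2n) has index k-1, arrow z_{2i} (i=1..n) index 2n+i-1 *)
Definition Gamma (n : nat) : quiver :=
  Quiver (2 * n) (bnd_arrows n ++ [seq (lab n (2 * i), lab n (2 * i + 2 * n - 2)) | i <- iota 1 n]).

Definition xa (n k : nat) : nat := (k + 2 * n - 1) %% (2 * n).
Definition za (n i : nat) : nat := 2 * n + (i + n - 1) %% n.

Definition Gamma_rels (K : numClosedFieldType) (n : nat) : seq (lc K) :=
  flatten [seq [:: rel K (lab n (2 * i))
                      [:: xa n (2 * i + 1); xa n (2 * i + 2); za n (i + 1)]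
                      [:: za n i; xa n (2 * i + 2 * n - 1); xa n (2 * i)];
                   rel K (lab n (2 * i))
                      [:: za n i; za n (i + n - 1)]
                      [seq xa n (2 * i + 1 + j) | j <- iota 0 (2 * n - 4)]]
          | i <- iota 1 n].

Definition t_elem (K : numClosedFieldType) (n : nat) : lc K :=
  [seq (1%R, apath (Gamma n) [:: xa n (2 * i - 1); xa n (2 * i); za n i]) | i <- iota 1 n]
  ++ [seq (1%R, apath (Gamma n) [:: xa n (2 * i); za n i; xa n (2 * i - 1)]) | i <- iota 1 n].

Definition phi_path (K : numClosedFieldType) (Q : quiver) (E A : nat -> lc K) (p : qpath) : lc K :=
  foldl (lc_mul Q) (E p.1) (map A p.2).

Definition phi (K : numClosedFieldType) (G Q : quiver) (E A : nat -> lc K) (f : lc K) : lc K :=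
  flatten [seq lc_scale c.1 (phi_path Q E A c.2) | c <- f & pvalid G c.2].

(* Main.v *)
Require Import Defs.
From HB Require Import structures.
From mathcomp Require Import all_boot all_order all_algebra.
From mathcomp Require Import zify.
Set Implicit Arguments. Unset Strict Implicit. Unset Printing Implicit Defensive.
Import GRing.Theory.

(* All relations are differences of two paths. Give each boundary arrow weight 1, each arrow z weight
   n - 2, and each arrow at a corner of a triangle the angle of that corner, in units of pi/n, when the
   polygon is regular. All relations are then homogeneous.

   In Gamma(n) the relations rewrite each path to x...x, zx...x or xzx...x, so that start, end and weight
   determine the class of a path: the two values of the number of z's modulo 2 are told apart by
   weight + start - end modulo 2n. Hence an ideal element is one whose coefficients sum to zero over each
   (start, end, weight), which gives injectivity as well as the centrality of t.

   The arrow z at the corner v_a is sent to the fan of all triangle arrows at v_a. If ab is a side or a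
   diagonal, the fan at a up to ab followed by the fan at b from ab equals x^(2(b-a-1)): this follows by
   induction on b - a, using the black face of the triangle akb on ab. For b = a - 1 it is the second
   relation of Gamma(n). The same face relations push the turns of an arbitrary path to the boundary: each path
   starting at the boundary is a product of x's and full fans followed by one partial fan, whence surjectivity.

   Vertices of the polygon are represented by natural numbers modulo n; a triangle is given by
   a < b < c < a + n. *)

(** * Path congruences and ideals *)

Section Paths.
Variable Q : quiver.

Lemma pend_cat s p q : pend Q (s, p ++ q) = pend Q (pend Q (s, p), q).
Proof. by rewrite /pend /= map_cat last_cat. Qed.

Lemma pend_cons s a q : pend Q (s, a :: q) = pend Q (tgt Q a, q).
Proof. by []. Qed.

Lemma pend_seq1 s x : pend Q (s, [:: x]) = tgt Q x.
Proof. by []. Qed.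

Lemma chain_cat s p q :
  chain Q s (p ++ q) = chain Q s p && chain Q (pend Q (s, p)) q.
Proof. by elim: p s => //= a p IH s; rewrite IH !andbA. Qed.

(** At each step [find] picks an arrow of [S] that starts where the current one ends. Since sources
    are distinct in [S], this can only be the next arrow of the given path, whatever the order of
    [S]. *)
Lemma walk_path (S : seq nat) a l : {in S &, injective (src Q)} -> all (mem S) (a :: l) ->
  path (fun x y => tgt Q x == src Q y) a l -> walk Q S a (size (a :: l)) = a :: l.
Proof.
move=> inj; elim: l a => [//|b l IH] a /= /and3P[aS bS lS] /andP[/eqP ab pl].
congr (_ :: _).
suff -> : nth a S (find (fun b => src Q b == tgt Q a) S) = b by apply: IH; rewrite /= ?bS.
have hs : has (fun b => src Q b == tgt Q a) S by apply/hasP; exists b; rewrite // -ab.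
have /eqP e := nth_find a hs.
by apply: inj => //; rewrite ?mem_nth -?has_find // e.
Qed.

Variable R : seq (nat * seq nat * seq nat).

(** The congruence on paths generated by binomial relations. Working with single paths from a fixed
    start [s] keeps linear combinations out of the combinatorial part; [peqv_cong] carries the
    result over to the ideal. *)
Inductive peqv (s : nat) : seq nat -> seq nat -> Prop :=
| Peqv_refl p : peqv s p p
| Peqv_sym p q : peqv s p q -> peqv s q p
| Peqv_trans p q r : peqv s p q -> peqv s q r -> peqv s p r
| Peqv_step p u v q :
    (pend Q (s, p), u, v) \in R -> peqv s (p ++ u ++ q) (p ++ v ++ q).

Lemma peqv_rel s u v : (s, u, v) \in R -> peqv s u v.
Proof. by move=> h; have := @Peqv_step s [::] u v [::] h; rewrite !cats0. Qed.

Lemma peqv_ctx s p q l l' :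
  peqv (pend Q (s, p)) l l' -> peqv s (p ++ l ++ q) (p ++ l' ++ q).
Proof.
elim=> [l0|l0 l1 _ IH|l0 l1 l2 _ IH1 _ IH2|r u v t h].
- exact: Peqv_refl.
- exact: Peqv_sym.
- exact: Peqv_trans IH1 IH2.
- rewrite -!catA !(catA p r); apply: Peqv_step.
  by rewrite pend_cat.
Qed.

Lemma peqv_catl s p l l' : peqv (pend Q (s, p)) l l' -> peqv s (p ++ l) (p ++ l').
Proof. by move=> h; have := peqv_ctx [::] h; rewrite !cats0. Qed.

Lemma peqv_catr s q l l' : peqv s l l' -> peqv s (l ++ q) (l' ++ q).
Proof. by move=> h; have := @peqv_ctx s [::] q l l' h. Qed.

Variable w : nat -> nat.

Definition wsum (l : seq nat) : nat := sumn (map w l).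

Lemma wsum_cons a l : wsum (a :: l) = w a + wsum l.
Proof. by []. Qed.

Lemma wsum_nil : wsum [::] = 0.
Proof. by []. Qed.

Lemma wsum_cat p q : wsum (p ++ q) = wsum p + wsum q.
Proof. by rewrite /wsum map_cat sumn_cat. Qed.

Definition homog : Prop := forall s u v, (s, u, v) \in R ->
  [/\ chain Q s u, chain Q s v, pend Q (s, u) = pend Q (s, v) & wsum u = wsum v].

(** Start, end and weight: constant on congruence classes for homogeneous relations, and a complete
    invariant for Gamma(n) by [gamma_unique]. *)
Definition cls (p : qpath) : nat * nat * nat := (p.1, pend Q p, wsum p.2).

Hypothesis homR : homog.

Lemma peqv_inv s p q : peqv s p q ->
  [/\ chain Q s p = chain Q s q, pend Q (s, p) = pend Q (s, q) & wsum p = wsum q].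
Proof.
elim=> {p q} [p|p q _ [-> -> ->]|p q r _ [-> -> ->] _ [-> -> ->]|p u v q h] //.
have [cu cv e we] := homR h.
by rewrite !chain_cat !pend_cat !wsum_cat cu cv e we.
Qed.

End Paths.

(** * Linear combinations of paths and membership in a binomial ideal *)

Section Ideals.
Variables (K : numClosedFieldType) (Q : quiver).
Local Open Scope ring_scope.
Implicit Types (f g : lc K) (p : qpath) (P : pred qpath).

(** Covers both single coefficients ([P] a singleton) and sums over a class of paths. Invalid paths
    are left out, as they stand for 0. *)
Definition csum P f : K := \sum_(c <- f | pvalid Q c.2 && P c.2) c.1.

Lemma coef_csum f p : coef Q f p = csum (pred1 p) f.
Proof.
rewrite /coef /csum; case: ifP => hp.
  by apply: eq_bigl => c /=; case: eqP => [->|]; rewrite ?hp ?andbF.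
by rewrite big1 // => c /andP[h /eqP e]; rewrite e hp in h.
Qed.

Lemma csum_cat P f g : csum P (f ++ g) = csum P f + csum P g.
Proof. exact: big_cat. Qed.

Lemma csum_cons P c f :
  csum P (c :: f) = (if pvalid Q c.2 && P c.2 then c.1 else 0) + csum P f.
Proof. by rewrite /csum big_cons; case: ifP; rewrite ?add0r. Qed.

Lemma csum_nil P : csum P [::] = 0.
Proof. exact: big_nil. Qed.

Lemma csum_scale P k f : csum P (lc_scale k f) = k * csum P f.
Proof. by rewrite /csum /lc_scale big_map mulr_sumr. Qed.

Lemma csum_flatten P (I : Type) (F : I -> lc K) (s : seq I) :
  csum P (flatten [seq F i | i <- s]) = \sum_(i <- s) csum P (F i).
Proof. by elim: s => [|i s IH]; rewrite ?big_nil ?csum_nil //= csum_cat IH big_cons. Qed.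

Lemma csum_mul P f g : csum P (lc_mul Q f g) =
  \sum_(c <- f) \sum_(d <- g | [&& pend Q c.2 == d.2.1,
     pvalid Q (c.2.1, c.2.2 ++ d.2.2) & P (c.2.1, c.2.2 ++ d.2.2)]) c.1 * d.1.
Proof.
by rewrite /lc_mul csum_flatten; apply: eq_bigr => c _; rewrite /csum big_map big_filter_cond.
Qed.

(** [lc_eq] compares coefficients one path at a time; on the finite set [U] of all paths that occur,
    [csum P] is a sum of such coefficients. *)
Lemma csum_lc_eq P f g : lc_eq Q f g -> csum P f = csum P g.
Proof.
move=> efg; pose U := undup (map snd f ++ map snd g).
have key h : {subset map snd h <= U} ->
    csum P h = \sum_(p <- U) if P p then coef Q h p else 0.
  elim: h => [_|c h IH sub].
    by rewrite csum_nil big1 // => p _; rewrite coef_csum csum_nil if_same.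
  rewrite csum_cons IH; last by move=> p hp; apply: sub; rewrite inE hp orbT.
  have cU : c.2 \in U by apply: sub; rewrite inE eqxx.
  under [RHS]eq_bigr => p _ do rewrite coef_csum csum_cons -coef_csum.
  have -> : (if pvalid Q c.2 && P c.2 then c.1 else 0)
      = \sum_(p <- U) if P p && (pvalid Q c.2 && (c.2 == p)) then c.1 else 0.
    rewrite (bigD1_seq c.2) ?undup_uniq //= eqxx andbT andbC big1 ?addr0 // => p.
    by rewrite eq_sym => /negbTE ->; rewrite !andbF.
  rewrite -big_split /=; apply: eq_bigr => p _.
  by case: (P p) => //=; rewrite addr0.
rewrite !key.
- by apply: eq_bigr => p _; rewrite efg.
- by move=> p hp; rewrite mem_undup mem_cat hp orbT.
- by move=> p hp; rewrite mem_undup mem_cat hp.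
Qed.

Lemma lc_eq_csum f g : (forall p, csum (pred1 p) f = csum (pred1 p) g) -> lc_eq Q f g.
Proof. by move=> h p; rewrite !coef_csum. Qed.

Lemma lc_eq_trans f g h : lc_eq Q f g -> lc_eq Q g h -> lc_eq Q f h.
Proof. by move=> e1 e2 p; rewrite e1. Qed.

Section AnyIdeal.
Variable R : seq (lc K).

Lemma in_ideal_eq f g : lc_eq Q f g -> in_ideal Q R g -> in_ideal Q R f.
Proof. by move=> e [ts h]; exists ts; apply: lc_eq_trans h. Qed.

Lemma in_ideal0 f : (forall p, csum (pred1 p) f = 0) -> in_ideal Q R f.
Proof. by move=> h; exists [::]; apply: lc_eq_csum => p; rewrite h csum_nil. Qed.

Lemma in_ideal_cat f g : in_ideal Q R f -> in_ideal Q R g -> in_ideal Q R (f ++ g).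
Proof.
move=> [ts h] [us h']; exists (ts ++ us); apply: lc_eq_csum => p.
by rewrite map_cat flatten_cat !csum_cat (csum_lc_eq _ h) (csum_lc_eq _ h').
Qed.

Lemma in_ideal_scale k f : in_ideal Q R f -> in_ideal Q R (lc_scale k f).
Proof.
move=> [ts h]; exists [seq (k * t.1.1.1, t.1.1.2, t.1.2, t.2) | t <- ts].
apply: lc_eq_csum => p; rewrite csum_scale (csum_lc_eq _ h) -map_comp !csum_flatten.
by rewrite mulr_sumr; apply: eq_bigr => t _; rewrite !csum_scale mulrA.
Qed.

Lemma in_ideal_flatten (I : eqType) (F : I -> lc K) (s : seq I) :
  (forall i, i \in s -> in_ideal Q R (F i)) -> in_ideal Q R (flatten [seq F i | i <- s]).
Proof.
elim: s => [|i s IH] h /=; first by apply: in_ideal0 => p; rewrite csum_nil.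
apply: in_ideal_cat; first by apply: h; rewrite inE eqxx.
by apply: IH => j hj; apply: h; rewrite inE hj orbT.
Qed.

Lemma cong_eq f g : lc_eq Q f g -> cong Q R f g.
Proof.
move=> e; apply: in_ideal0 => p.
by rewrite csum_cat csum_scale (csum_lc_eq _ e) mulN1r addrN.
Qed.

Lemma cong_cat f f' g g' : cong Q R f g -> cong Q R f' g' -> cong Q R (f ++ f') (g ++ g').
Proof.
move=> h h'; apply: in_ideal_eq (in_ideal_cat h h'); apply: lc_eq_csum => p.
by rewrite !csum_cat !csum_scale !csum_cat mulrDr addrACA.
Qed.

Lemma cong_trans f g h : cong Q R f g -> cong Q R g h -> cong Q R f h.
Proof.
move=> e1 e2; apply: in_ideal_eq (in_ideal_cat e1 e2); apply: lc_eq_csum => p.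
by rewrite !csum_cat !csum_scale !mulN1r addrA addrNK.
Qed.

End AnyIdeal.

Variable R0 : seq (nat * seq nat * seq nat).
Let R : seq (lc K) := [seq Defs.rel K r.1.1 r.1.2 r.2 | r <- R0].

Lemma lc_mul_mono k l p q :
  lc_mul Q [:: (k, p)] [:: (l, q)] =
  if pend Q p == q.1 then [:: (k * l, (p.1, p.2 ++ q.2))] else [::] :> lc K.
Proof. by rewrite /lc_mul /=; case: eqP. Qed.

Lemma lc_mul_rel p s u v :
  lc_mul Q [:: (1, p)] (Defs.rel K s u v) =
  if pend Q p == s then [:: (1, (p.1, p.2 ++ u)); (-1, (p.1, p.2 ++ v))] else [::].
Proof. by rewrite /lc_mul /Defs.rel /=; case: eqP; rewrite //= !mul1r. Qed.

Variable w : nat -> nat.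
Hypothesis homR : homog Q R0 w.

Lemma peqv_cong (k : K) s (p q : seq nat) : peqv Q R0 s p q -> cong Q R [:: (k, (s, p))] [:: (k, (s, q))].
Proof.
elim=> {p q} [p|p q _ IH|p q r _ IH1 _ IH2|p u v q h].
- exact: cong_eq.
- apply: in_ideal_eq (in_ideal_scale (-1) IH); apply: lc_eq_csum => t.
  by rewrite !(csum_cat, csum_scale) !mulN1r opprD opprK addrC.
- exact: cong_trans IH1 IH2.
have [_ _ e _] := homR h.
(* One ideal term suffices, p(u - v)q with coefficient [k]. Its right factor starts at the common
   end of p u and p v. *)
exists [:: (k, (s, p), index (pend Q (s, p), u, v) R0, (pend Q (s, p ++ u), q))].
apply: lc_eq_csum => t /=.
rewrite (nth_map (0, [::], [::])) ?index_mem // nth_index // lc_mul_rel eqxx /=.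
rewrite /lc_mul /= eqxx.
have -> : pend Q (s, p ++ v) == pend Q (s, p ++ u) by rewrite !pend_cat e.
rewrite /= /lc_scale /= !mulr1 -!catA.
by congr (csum _ [:: _; (_, _)]); rewrite mulrC.
Qed.

(* The ideal is spanned by differences of paths of equal class, so class sums vanish on it. *)
Lemma in_ideal_csum f : in_ideal Q R f -> forall k, csum (fun p => cls Q w p == k) f = 0.
Proof.
move=> [ts h] k; rewrite (csum_lc_eq _ h) csum_flatten big1_seq // => -[[[x p] i] q] _ /=.
(* An index beyond the list of relations selects the default, the empty combination, which
   contributes 0. *)
rewrite csum_scale; case: (ltnP i (size R0)) => hi; last first.
  by rewrite nth_default ?size_map //= csum_nil mulr0.
rewrite (nth_map (0%N, [::], [::])) //.
case e: (nth _ R0 i) => [[s u] v] /=; rewrite lc_mul_rel.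
case: eqP => [es|_]; last by rewrite csum_nil mulr0.
have hR : (pend Q p, u, v) \in R0 by rewrite es -e mem_nth.
have [_ _ e1 _] := homR hR.
have hp : p = (p.1, p.2) by case: p {es hR e1 h}.
rewrite {1}hp in hR; rewrite {1 2}hp in e1.
have [/= c1 c2 c3] := peqv_inv homR (Peqv_step q.2 hR).
rewrite /lc_mul /=.
have -> : pend Q (p.1, p.2 ++ v) = pend Q (p.1, p.2 ++ u) by rewrite !pend_cat -e1.
case: eqP => _ /=; last by rewrite csum_nil mulr0.
rewrite !csum_cons csum_nil /= /pvalid /cls /= -!catA c1 c2 c3.
by case: ifP => _; rewrite ?addr0 ?mulr0 // !mulr1 addrN mulr0.
Qed.

(** Subtracting from each path a representative of its class changes [f] by an element of the ideal;
    what remains is each representative times its class sum, hence 0. Equivalence is asked only of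
    paths occurring in [f], so that the lemma also applies to images under [phi] in the dimer
    quiver. *)
Lemma csum_in_ideal f :
  (forall p q, p \in map snd f -> q \in map snd f -> pvalid Q p -> pvalid Q q ->
     cls Q w p = cls Q w q -> peqv Q R0 p.1 p.2 q.2) ->
  (forall k, csum (fun p => cls Q w p == k) f = 0) -> in_ideal Q R f.
Proof.
move=> eqv zs.
pose same (c : K * qpath) := fun d : K * qpath => pvalid Q d.2 && (cls Q w d.2 == cls Q w c.2).
(* The representative is the first valid entry of [f] in the class of [c], so entries of equal class
   share it ([repE]). *)
pose rep (c : K * qpath) := (nth c f (find (same c) f)).2.
have repP (c : K * qpath) : c \in f -> pvalid Q c.2 ->
    [/\ rep c \in map snd f, pvalid Q (rep c) & cls Q w (rep c) = cls Q w c.2].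
  move=> hc vc; have hs : has (same c) f by apply/hasP; exists c => //; rewrite /same vc /=.
  have /andP[v1 /eqP e1] := nth_find c hs.
  by split=> //; apply: map_f; rewrite mem_nth -?has_find.
have repE c d : c \in f -> d \in f -> pvalid Q c.2 -> cls Q w c.2 = cls Q w d.2 -> rep c = rep d.
  move=> hc hd vc e; rewrite /rep.
  have -> : find (same d) f = find (same c) f by apply: eq_find => x; rewrite /same e.
  by rewrite (set_nth_default d) // -has_find; apply/hasP; exists c => //; rewrite /same vc /=.
pose fv := [seq c <- f | pvalid Q c.2].
have I0 : in_ideal Q R (flatten [seq [:: c] ++ lc_scale (-1) [:: (c.1, rep c)] | c <- fv]).
  apply: in_ideal_flatten => c; rewrite mem_filter => /andP[vc hc].
  have [r1 r2 r3] := repP c hc vc.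
  have e1 : (rep c).1 = c.2.1 by case: r3.
  have := peqv_cong c.1 (eqv _ _ (map_f snd hc) r1 vc r2 (esym r3)).
  by rewrite -{2}e1 -!surjective_pairing; case: (c).
apply: in_ideal_eq I0; apply: lc_eq_csum => p.
rewrite csum_flatten.
under eq_bigr => c _ do rewrite csum_cat csum_scale mulN1r !csum_cons !csum_nil !addr0.
rewrite big_split /= sumrN.
(* If [p] represents the class of some [d], the entries represented by [p] are exactly those in this
   class, and the sum is a class sum; otherwise it is empty. *)
have -> : \sum_(c <- fv) (if pvalid Q (rep c) && (rep c == p) then c.1 else 0) = 0.
  rewrite big_seq -big_mkcondr /=.
  case: (boolP (has (fun c => rep c == p) fv)) => [/hasP[d hd /eqP ed]|/hasPn no]; last first.
    by apply: big_pred0 => c; apply/negP => /andP[/no/negbTE->]; rewrite andbF.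
  move: (hd); rewrite mem_filter => /andP[vd hd'].
  rewrite -[RHS](zs (cls Q w d.2)) /csum -[RHS]big_filter_cond -/fv [RHS]big_seq_cond.
  apply: eq_bigl => c; case hc: (c \in fv) => //=.
  move: hc; rewrite mem_filter => /andP[vc hc]; have [r1 r2 r3] := repP c hc vc.
  rewrite r2 /=; apply/eqP/eqP => [e|e]; last by rewrite (repE _ d).
  by have [_ _ <-] := repP d hd' vd; rewrite ed -e.
rewrite subr0 /csum -big_mkcond big_filter_cond.
by apply: eq_bigl => c; rewrite andbA andbb.
Qed.

End Ideals.

(** * Triangulations in cyclic coordinates *)

Lemma minnmaxn_lt i j : i < j -> (minn i j = i) * (maxn i j = j) * (minn j i = i) * (maxn j i = j).
Proof. by move=> h; rewrite !minnE !maxnE; do !split; lia. Qed.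

Lemma modn_eq q d x y : x = q * d + y -> x = y %[mod d].
Proof. by move=> ->; rewrite modnMDl. Qed.

Lemma uniq_flatten_map (A B : eqType) (F : A -> seq B) (s : seq A) :
  uniq s -> {in s, forall x, uniq (F x)} ->
  {in s &, forall x y z, z \in F x -> z \in F y -> x = y} ->
  uniq (flatten [seq F x | x <- s]).
Proof.
elim: s => //= x s IH /andP[xs us] h1 h2; rewrite cat_uniq h1 ?mem_head //=.
rewrite IH ?andbT //.
- apply/hasPn => z /flatten_mapP[y ys zy]; apply/negP => zx.
  by move: xs; rewrite (h2 x y _ _ z zx zy) ?ys ?mem_head // inE ys orbT.
- by move=> y ys; apply: h1; rewrite inE ys orbT.
- by move=> y z ys zs; apply: h2; rewrite inE (ys, zs) orbT.
Qed.

Lemma size_flatten3 (A B : Type) (F : A -> seq B) (s : seq A) :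
  (forall x, size (F x) = 3) -> size (flatten [seq F x | x <- s]) = 3 * size s.
Proof. by move=> h; elim: s => //= x s IH; rewrite size_cat h IH mulnS. Qed.

Lemma nth_flatten3 (A B : Type) (F : A -> seq B) (s : seq A) a0 x0 m r :
  (forall x, size (F x) = 3) -> r < 3 -> m < size s ->
  nth x0 (flatten [seq F x | x <- s]) (3 * m + r) = nth x0 (F (nth a0 s m)) r.
Proof.
move=> h hr; elim: s m => //= x s IH [|m] hm; rewrite nth_cat h; first by rewrite muln0 hr.
by rewrite mulnS -addnA ltnNge leq_addr /= addKn IH.
Qed.

(** The dimer relations as triples of start and two paths, the form in which [peqv] takes its
    relations. *)
Definition dimer_trips (D : dimer) : seq (nat * seq nat * seq nat) :=
  flatten [seq flatten [seq [seq (tgt (dq D) a, rest F a, rest G a)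
                             | G <- dneg D & a \in G]
                        | F <- dpos D & a \in F]
          | a <- iota 0 (size (qarr (dq D)))].

Lemma dimer_relsE (K : numClosedFieldType) (D : dimer) :
  dimer_rels K D = [seq Defs.rel K r.1.1 r.1.2 r.2 | r <- dimer_trips D].
Proof.
rewrite /dimer_rels /dimer_trips map_flatten -map_comp; congr flatten.
apply: eq_map => a /=; rewrite map_flatten -map_comp; congr flatten.
by apply: eq_map => F /=; rewrite -map_comp.
Qed.

Section Triangulation.
Variables (n : nat) (T : seq (nat * nat)).
Hypotheses (n3 : 3 <= n) (trT : triangulation n T).

(** Sides of the polygon count as chords. [minn] and [maxn] restore the increasing order of residues
    in which [T] lists its diagonals. *)
Definition chord (a b : nat) : bool :=
  side n T (minn (a %% n) (b %% n)) (maxn (a %% n) (b %% n)).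

Definition tri (a b c : nat) : bool :=
  [&& a < b, b < c, c < a + n, chord a b, chord b c & chord a c].

Definition cmid (a b : nat) : nat :=
  mid n T (minn (a %% n) (b %% n)) (maxn (a %% n) (b %% n)).

Lemma chordC a b : chord a b = chord b a.
Proof. by rewrite /chord minnC maxnC. Qed.

Lemma cmidC a b : cmid a b = cmid b a.
Proof. by rewrite /cmid minnC maxnC. Qed.

Lemma chord_mod a b c d : a = c %[mod n] -> b = d %[mod n] -> chord a b = chord c d.
Proof. by rewrite /chord => -> ->. Qed.

Lemma cmid_mod a b c d : a = c %[mod n] -> b = d %[mod n] -> cmid a b = cmid c d.
Proof. by rewrite /cmid => -> ->. Qed.

Lemma tri_lt a b c : tri a b c -> [/\ a < b, b < c & c < a + n].
Proof. by case/and4P. Qed.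

Lemma tri_chord a b c : tri a b c -> [/\ chord a b, chord b c & chord a c].
Proof. by case/and5P => _ _ _ -> /andP[-> ->]. Qed.

Lemma triI a b c : a < b -> b < c -> c < a + n ->
  chord a b -> chord b c -> chord a c -> tri a b c.
Proof. by rewrite /tri => -> -> -> -> -> ->. Qed.

Lemma tri_rot a b c : tri a b c -> tri b c (a + n).
Proof.
move=> h; have [l1 l2 l3] := tri_lt h; have [s1 s2 s3] := tri_chord h.
apply: triI => //; try lia.
- by rewrite chordC (chord_mod (modnDr a n) (erefl (c %% n))).
- by rewrite chordC (chord_mod (modnDr a n) (erefl (b %% n))).
Qed.

Lemma tri_shift q a b c : tri (q * n + a) (q * n + b) (q * n + c) = tri a b c.
Proof. by rewrite /tri /chord !modnMDl; congr [&& _, _, _, _, _ & _]; lia. Qed.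

Lemma mod_wrap x : x < 2 * n -> x %% n = if x < n then x else x - n.
Proof.
move=> h; case: ltnP => hx; first exact: modn_small.
by rewrite -{1}(subnK hx) modnDr modn_small //; lia.
Qed.

Lemma chord_succ a : chord a a.+1.
Proof.
rewrite /chord /side /is_edge; apply/orP; left.
have h := ltn_pmod a (ltnW (ltnW n3)).
have -> : a.+1 %% n = (a %% n).+1 %% n by rewrite -addn1 -modnDml addn1.
by rewrite (mod_wrap (x := (a %% n).+1)); [case: ifP; lia | lia].
Qed.

Lemma side_noncross i k j l :
  i < k -> k < j -> j < l -> l < n -> side n T i j -> side n T k l -> False.
Proof.
move=> h1 h2 h3 h4; rewrite /side /is_edge.
have -> : (j == i.+1) || (i == 0) && (j == n.-1) = false by lia.
have -> : (l == k.+1) || (k == 0) && (l == n.-1) = false by lia.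
case: trT => _ _ nx _ /= m1 m2; have := nx _ _ m1 m2.
by rewrite /cross /= h1 h2 h3.
Qed.

Lemma lift_reduce a : exists q r, [/\ a = q * n + r & r < n].
Proof. by exists (a %/ n), (a %% n); rewrite -divn_eq ltn_pmod //; lia. Qed.

Lemma lift_from q b : q * n <= b -> exists b', b = q * n + b'.
Proof. by move=> h; exists (b - q * n); rewrite subnKC. Qed.

(** With [a] moved into [0, n), the four cases record how many of [b], [c], [d] have passed [n];
    reducing those modulo n rotates the cyclic order and leaves the linear statement
    [side_noncross]. *)
Lemma chord_noncross a b c d :
  a < b -> b < c -> c < d -> d < a + n -> chord a c -> chord b d -> False.
Proof.
have [q [r [-> hr]]] := lift_reduce a => h1 h2 h3 h4.
have [b' eb] := @lift_from q _ (ltac:(lia) : q * n <= b).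
have [c' ec] := @lift_from q _ (ltac:(lia) : q * n <= c).
have [d' ed] := @lift_from q _ (ltac:(lia) : q * n <= d).
rewrite eb ec ed.
have {}h1 : r < b' by lia.
have {}h2 : b' < c' by lia.
have {}h3 : c' < d' by lia.
have {}h4 : d' < r + n by lia.
rewrite /chord !modnMDl !mod_wrap; try lia.
have -> : r < n by [].
case: (ltnP d' n) => k1.
  have -> : c' < n by lia.
  have -> : b' < n by lia.
  rewrite (@minnmaxn_lt r c') ?(@minnmaxn_lt b' d'); try lia.
  by apply: side_noncross; lia.
case: (ltnP c' n) => k2.
  have -> : b' < n by lia.
  rewrite (@minnmaxn_lt r c') ?(@minnmaxn_lt (d' - n) b'); try lia.
  by move=> s1 s2; apply: (side_noncross _ _ _ _ s2 s1); lia.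
case: (ltnP b' n) => k3.
  rewrite (@minnmaxn_lt (c' - n) r) ?(@minnmaxn_lt (d' - n) b'); try lia.
  by apply: side_noncross; lia.
rewrite (@minnmaxn_lt (c' - n) r) ?(@minnmaxn_lt (b' - n) (d' - n)); try lia.
by move=> s1 s2; apply: (side_noncross _ _ _ _ s2 s1); lia.
Qed.

(** By maximality of [T] a missing diagonal is crossed by one of [T]. The lifts of its ends are then
    chosen so that [c] lies between [a] and [b], and [d] between [b] and [a + n]. *)
Lemma chord_maximal a b : a.+1 < b -> b.+1 < a + n -> ~~ chord a b ->
  exists c d, [/\ a < c, c < b, b < d, d < a + n & chord c d].
Proof.
have [q [r [-> hr]]] := lift_reduce a => h1 h2.
have [b' eb] := @lift_from q _ (ltac:(lia) : q * n <= b).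
rewrite eb.
have {}h1 : r.+1 < b' by lia.
have {}h2 : b'.+1 < r + n by lia.
have main : ~~ chord r b' ->
    exists c d, [/\ r < c, c < b', b' < d, d < r + n & chord c d].
  have chS e : e \in T -> [/\ e.1 < e.2, e.2 < n & side n T e.1 e.2].
    case: trT => _ /allP al _ _ he; have /and4P[k1 k2 _ _] := al _ he.
    by split=> //; rewrite /side -surjective_pairing he orbT.
  have [_ _ _ mx] := trT.
  rewrite /chord !mod_wrap; try lia.
  have -> : r < n by [].
  case: (ltnP b' n) => k1.
    rewrite !(@minnmaxn_lt r b'); try lia.
    rewrite /side negb_or => /andP[_ nT].
    have /mx/(_ nT)/hasP[[x y] eT] : is_diag n (r, b').
      by rewrite /is_diag /=; lia.
    have [/= e1 e2 sd] := chS _ eT.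
    rewrite /cross /= => hX.
    have [hx|hx] : r < x < b' /\ b' < y \/ x < r < y /\ y < b' by lia.
      exists x, y; split; try lia.
      rewrite /chord !modn_small; try lia.
      by rewrite !(@minnmaxn_lt x y).
    exists y, (x + n); split; try lia.
    rewrite /chord modnDr !modn_small; try lia.
    by rewrite !(@minnmaxn_lt x y).
  rewrite !(@minnmaxn_lt (b' - n) r); try lia.
  rewrite /side negb_or => /andP[_ nT].
  have /mx/(_ nT)/hasP[[x y] eT] : is_diag n (b' - n, r).
    by rewrite /is_diag /=; lia.
  have [/= e1 e2 sd] := chS _ eT.
  rewrite /cross /= => hX.
  have [hx|hx] : (b' - n < x < r /\ r < y) \/ (x < b' - n < y /\ y < r) by lia.
    exists y, (x + n); split; try lia.
    rewrite /chord modnDr !modn_small; try lia.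
    by rewrite !(@minnmaxn_lt x y).
  exists (x + n), (y + n); split; try lia.
  rewrite /chord !modnDr !modn_small; try lia.
  by rewrite !(@minnmaxn_lt x y).
rewrite {1}/chord !modnMDl => /main[c [d [k1 k2 k3 k4 k5]]].
exists (q * n + c), (q * n + d); split; try lia.
by rewrite /chord !modnMDl.
Qed.

(** The apex [k] is the last vertex before [b] joined to [a]. Were [kb] not a chord, some chord [cd]
    would cross it, with [c] between [k] and [b]. Then [cd] crosses [ab] if d < a + n and [ak] if d
    > a + n, while d = a + n makes [c] a later neighbour of [a]. *)
Lemma chord_apex a b : a.+1 < b -> b < a + n -> chord a b ->
  exists k, tri a k b.
Proof.
move=> h1 h2 sab.
have ex : exists k, (a < k < b) && chord a k by exists a.+1; rewrite chord_succ; lia.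
have bd k : (a < k < b) && chord a k -> k <= b by lia.
case: (ex_maxnP ex bd) => k /andP[/andP[k1 k2] sak] mx.
exists k; apply: triI => //; apply/negPn/negP => nkb.
have k3 : k.+1 < b.
  rewrite ltn_neqAle k2 andbT; apply: contraNneq nkb => <-; exact: chord_succ.
have [c [d [l1 l2 l3 l4 scd]]] := chord_maximal k3 (ltac:(lia) : b.+1 < k + n) nkb.
case: (ltngtP d (a + n)) => hd.
- by apply: (chord_noncross _ _ _ _ sab scd); lia.
- have scd' : chord (d - n) c.
    by rewrite chordC -(chord_mod (erefl (c %% n)) (modnDr (d - n) n)) subnK //; lia.
  by apply: (chord_noncross _ _ _ _ sak scd' ); lia.
- have : chord a c by rewrite chordC -(chord_mod (erefl (c %% n)) (modnDr a n)) -hd.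
  by move=> sac; have := mx c; rewrite sac; lia.
Qed.

(** The triangle on the other side of [ab] is the one found by [chord_apex] for the chord from [b]
    to [a + n]. *)
Lemma chord_next a b : a < b -> b.+1 < a + n -> chord a b -> exists c, tri a b c.
Proof.
move=> h1 h2 sab.
have s' : chord b (a + n) by rewrite (chord_mod (erefl (b %% n)) (modnDr a n)) chordC.
have [k tk] := chord_apex h2 (ltac:(lia) : a + n < b + n) s'.
have [l1 l2 l3] := tri_lt tk; have [s1 s2 s3] := tri_chord tk.
exists k; apply: triI => //.
by rewrite chordC -(chord_mod (erefl (k %% n)) (modnDr a n)).
Qed.

Lemma tri_gap a b c d : tri a b c -> b < d -> d < c -> ~~ chord a d.
Proof.
move=> h d1 d2; apply/negP => sad; have [l1 l2 l3] := tri_lt h.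
have [s1 s2 s3] := tri_chord h.
by apply: (chord_noncross _ _ _ _ sad s2); lia.
Qed.

(** The first vertex after [b] joined to [a]. It is the third vertex of the triangle following [ab],
    because a chord from [a] ending earlier would cross the opposite side ([tri_gap]). *)
Definition nextn (a b : nat) : nat := b.+1 + find (chord a) (iota b.+1 n).

Lemma nextnE a b c : tri a b c -> nextn a b = c.
Proof.
move=> h; have [l1 l2 l3] := tri_lt h; have [s1 s2 s3] := tri_chord h.
rewrite /nextn; have -> : n = (c - b.+1) + (n - (c - b.+1)).-1.+1 by lia.
rewrite iotaD find_cat ifN; last first.
  apply/hasPn => d; rewrite mem_iota => hd; apply: tri_gap h _ _; lia.
rewrite size_iota /= subnKC // s3; lia.
Qed.

Lemma tri_uniq a b c c' : tri a b c -> tri a b c' -> c = c'.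
Proof. by move=> /nextnE <- /nextnE <-. Qed.

Lemma cmid_succ a : cmid a a.+1 = 2 * (a %% n) + 1.
Proof.
rewrite /cmid /mid.
have h := ltn_pmod a (ltnW (ltnW n3)).
have -> : a.+1 %% n = (a %% n).+1 %% n by rewrite -addn1 -modnDml addn1.
rewrite (mod_wrap (x := (a %% n).+1)); last lia.
case: (ltnP (a %% n).+1 n) => hx.
  by rewrite !(@minnmaxn_lt (a %% n) (a %% n).+1) ?eqxx //; lia.
rewrite !(@minnmaxn_lt ((a %% n).+1 - n) (a %% n)); try lia.
by repeat case: ifP; lia.
Qed.

Lemma cmid_pred a : cmid a (a + n.-1) = (2 * (a %% n) + 2 * n - 1) %% (2 * n).
Proof.
have -> : cmid a (a + n.-1) = cmid (a + n.-1) (a + n.-1).+1.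
  rewrite cmidC; apply: cmid_mod => //.
  by rewrite -addnS prednK ?modnDr; lia.
rewrite cmid_succ -modnDml; have := ltn_pmod a (ltnW (ltnW n3)); move: (a %% n) => r hr.
rewrite mod_wrap; last lia.
case: ltnP => hx.
  by rewrite modn_small; lia.
have -> : 2 * (r) + 2 * n - 1 = (2 * (r) - 1) + 2 * n by lia.
by rewrite modnDr modn_small; lia.
Qed.

Lemma mid_inj i j k l : i < j -> j < n -> k < l -> l < n ->
  side n T i j -> side n T k l -> mid n T i j = mid n T k l -> i = k /\ j = l.
Proof.
move=> h1 h2 h3 h4; rewrite /side /is_edge /mid.
case e1: (j == i.+1); case e2: (l == k.+1);
  case e3: ((i == 0) && (j == n.-1)); case e4: ((k == 0) && (l == n.-1)) => //= m1 m2 e; try lia.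
have {}e : index (i, j) T = index (k, l) T by lia.
have : (i, j) = (k, l) by rewrite -(nth_index (0, 0) m1) e nth_index.
by case.
Qed.

Lemma mod_neq a b : a < b -> b < a + n -> a %% n != b %% n.
Proof.
have [q [r [-> hr]]] := lift_reduce a => h1 h2.
have [b' eb] := @lift_from q _ (ltac:(lia) : q * n <= b).
rewrite eb.
by rewrite !modnMDl !mod_wrap; try lia; case: ifP; case: ifP; lia.
Qed.

(** A midpoint remembers only the unordered chord, hence two alternatives; in [fan_factored_rcons]
    they decide around which end of the chord a path continues. *)
Lemma cmid_inj a b c d : a < b -> b < a + n -> c < d -> d < c + n ->
  chord a b -> chord c d -> cmid a b = cmid c d ->
  a = c %[mod n] /\ b = d %[mod n] \/ a = d %[mod n] /\ b = c %[mod n].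
Proof.
move=> h1 h2 h3 h4; rewrite /chord /cmid.
have := mod_neq h1 h2; have := mod_neq h3 h4.
have := ltn_pmod a (ltnW (ltnW n3)); have := ltn_pmod b (ltnW (ltnW n3)).
have := ltn_pmod c (ltnW (ltnW n3)); have := ltn_pmod d (ltnW (ltnW n3)).
move: (a %% n) (b %% n) (c %% n) (d %% n) => i j k l hl hk hj hi nkl nij s1 s2 e.
have [] := mid_inj _ _ _ _ s1 s2 e; rewrite ?minnE ?maxnE; lia.
Qed.

Lemma mod_small_inj a b d : a < b -> b < a + n -> a < d -> d < a + n ->
  b = d %[mod n] -> b = d.
Proof.
move=> h1 h2 h3 h4 e.
have [q [r [ea hr]]] := lift_reduce a.
move: e; have [b' eb] := @lift_from q _ (ltac:(lia) : q * n <= b).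
have [d' ed] := @lift_from q _ (ltac:(lia) : q * n <= d).
by rewrite eb ed !modnMDl !mod_wrap; try lia; case: ifP; case: ifP; lia.
Qed.

Lemma cmid_inj_corner a b d : a < b -> b < a + n -> a < d -> d < a + n ->
  chord a b -> chord a d -> cmid a b = cmid a d -> b = d.
Proof.
move=> h1 h2 h3 h4 s1 s2 e.
have [[_]|[e1 e2]] := cmid_inj h1 h2 h3 h4 s1 s2 e; first exact: (mod_small_inj h1).
by have := mod_neq h1 h2; rewrite e2 eqxx.
Qed.

Lemma cmid_boundary a b : a < b -> b < a + n -> cmid a b < 2 * n ->
  b = a.+1 \/ b = a + n.-1.
Proof.
have [q [r [-> hr]]] := lift_reduce a => h1 h2.
have [b' eb] := @lift_from q _ (ltac:(lia) : q * n <= b).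
rewrite eb.
rewrite /cmid !modnMDl !mod_wrap; try lia.
have -> : r < n by [].
case: (ltnP b' n) => hb.
  rewrite !(@minnmaxn_lt r b'); try lia.
  by rewrite /mid; case: eqP => e1; [lia | case: ifP; lia].
rewrite !(@minnmaxn_lt (b' - n) r); try lia.
by rewrite /mid; case: eqP => e1; [lia | case: ifP; lia].
Qed.

(** * The list of triangles and the arrows at their corners *)

Lemma mem_triples i j k : ((i, j, k) \in triples n) = [&& i < n, j < n & k < n].
Proof.
apply/flatten_mapP/and3P => [[i' hi /flatten_mapP[j' hj /mapP[k' hk [-> -> ->]]]]|[hi hj hk]].
  by move: hi hj hk; rewrite !mem_iota.
exists i; rewrite ?mem_iota //; apply/flatten_mapP; exists j; rewrite ?mem_iota //.
by apply: map_f; rewrite mem_iota.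
Qed.

Lemma uniq_triples : uniq (triples n).
Proof.
apply: uniq_flatten_map; first exact: iota_uniq.
- move=> i _; apply: uniq_flatten_map; first exact: iota_uniq.
  + by move=> j _; rewrite map_inj_uniq ?iota_uniq // => x y [].
  + by move=> j j' _ _ z /mapP[k _ ->] /mapP[k' _ [->]].
- move=> i i' _ _ z /flatten_mapP[j _ /mapP[k _ ->]].
  by case/flatten_mapP=> j' _ /mapP[k' _ [->]].
Qed.

Let tris := triangles n T.

Lemma mem_tris i j k : ((i, j, k) \in tris) =
  [&& i < j, j < k, k < n, side n T i j, side n T j k & side n T i k].
Proof.
rewrite mem_filter mem_triples; apply/idP/idP.
  by case/andP=> /and5P[-> -> -> -> ->] /and3P[_ _ ->].
by case/and5P=> h1 h2 h3 -> /andP[-> ->]; rewrite h1 h2 h3 /= !andbT; lia.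
Qed.

Lemma uniq_tris : uniq tris.
Proof. exact/filter_uniq/uniq_triples. Qed.

(* The three rotations of a sorted triangle: the head is the corner, listed in the order used by [tri_corners]. *)
Definition rot3 (t : nat * nat * nat) (r : nat) : nat * nat * nat :=
  let: (i, j, k) := t in nth (i, j, k) [:: (i, j, k); (k, i, j); (j, k, i)] r.

(** The number of the arrow at the corner [i], for [i], [j], [k] in anticlockwise order. Following
    [tri_arrows], the offset is 0, 1 or 2 when [i] is the smallest, the largest or the middle of the
    three. *)
Definition arr3 (i j k : nat) : nat :=
  2 * n + if (i < j) && (j < k) then 3 * index (i, j, k) tris
          else if (j < k) && (k < i) then 3 * index (j, k, i) tris + 1
          else 3 * index (k, i, j) tris + 2.

Definition arr (a b c : nat) : nat := arr3 (a %% n) (b %% n) (c %% n).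

Lemma arr_mod a b c a' b' c' :
  a = a' %[mod n] -> b = b' %[mod n] -> c = c' %[mod n] -> arr a b c = arr a' b' c'.
Proof. by rewrite /arr => -> -> ->. Qed.

Lemma arr_shift q a b c : arr (q * n + a) (q * n + b) (q * n + c) = arr a b c.
Proof. by apply: arr_mod; rewrite modnMDl. Qed.

Lemma arr3_rot i j k r : i < j -> j < k -> r < 3 ->
  let t := rot3 (i, j, k) r in
  arr3 t.1.1 t.1.2 t.2 = 2 * n + (3 * index (i, j, k) tris + r).
Proof.
rewrite /arr3; case: r => [|[|[|]]] //= h1 h2 _; congr (_ + _).
- by rewrite h1 h2 addn0.
- by rewrite h1 h2 ifF //; lia.
- by rewrite !ifF //; lia.
Qed.

Lemma tri_rot3 a b c : tri a b c ->
  exists i j k r, [/\ (i, j, k) \in tris, r < 3 & rot3 (i, j, k) r = (a %% n, b %% n, c %% n)].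
Proof.
have [q [a' [-> hr]]] := lift_reduce a => h; have [h1 h2 h3] := tri_lt h.
have [b' eb] := @lift_from q _ (ltac:(lia) : q * n <= b).
have [c' ec] := @lift_from q _ (ltac:(lia) : q * n <= c).
move: h; rewrite eb ec tri_shift !modnMDl => h.
have {}h1 : a' < b' by lia.
have {}h2 : b' < c' by lia.
have {}h3 : c' < a' + n by lia.
have := tri_chord h; rewrite /chord !mod_wrap; try lia.
have -> : a' < n by [].
case: (ltnP c' n) => k1.
  have -> : b' < n by lia.
    rewrite !(@minnmaxn_lt a' b') ?(@minnmaxn_lt a' c') ?(@minnmaxn_lt b' c'); try lia.
  by case=> s1 s2 s3; exists a', b', c', 0; rewrite mem_tris s1 s2 s3 h1 h2 k1.
case: (ltnP b' n) => k2.
  rewrite !(@minnmaxn_lt a' b') ?(@minnmaxn_lt (c' - n) a') ?(@minnmaxn_lt (c' - n) b'); try lia.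
  by case=> s1 s2 s3; exists (c' - n), a', b', 2; rewrite mem_tris s1 s2 s3; split=> //; lia.
rewrite !(@minnmaxn_lt (b' - n) a') ?(@minnmaxn_lt (c' - n) a') ?(@minnmaxn_lt (b' - n) (c' - n)); try lia.
by case=> s1 s2 s3; exists (b' - n), (c' - n), a', 1; rewrite mem_tris s1 s2 s3; split=> //; lia.
Qed.

Lemma rot3_tri i j k r : (i, j, k) \in tris -> r < 3 ->
  exists a b c, [/\ a < n, tri a b c & rot3 (i, j, k) r = (a %% n, b %% n, c %% n)].
Proof.
rewrite mem_tris => /and5P[h1 h2 h3 s1 /andP[s2 s3]] hr.
have base : tri i j k.
  apply: triI => //; first lia; rewrite /chord !modn_small; try lia;
    by rewrite ?(minnmaxn_lt h1) ?(minnmaxn_lt h2) ?(minnmaxn_lt (ltn_trans h1 h2)).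
have base2 : tri j k (i + n) := tri_rot base.
have base3 : tri k (i + n) (j + n) := tri_rot base2.
case: r hr => [|[|[|]]] // _.
- by exists i, j, k; split; rewrite ?modn_small //=; lia.
- by exists k, (i + n), (j + n); split; rewrite ?modnDr ?modn_small //=; lia.
- by exists j, k, (i + n); split; rewrite ?modnDr ?modn_small //=; lia.
Qed.

Let Q := QT n T.

Lemma size_bnd : size (bnd_arrows n) = 2 * n.
Proof. by rewrite size_map size_iota. Qed.

Lemma size_qarr : size (qarr Q) = 2 * n + 3 * size tris.
Proof. by rewrite /= size_cat size_bnd size_flatten3 // => -[[]]. Qed.

Lemma nth_tri_arrow m r : m < size tris -> r < 3 ->
  let: (a, b, c) := rot3 (nth (0, 0, 0) tris m) r in
  nth (0, 0) (qarr Q) (2 * n + (3 * m + r)) = (cmid a b, cmid a c).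
Proof.
move=> hm hr; rewrite /= nth_cat size_bnd ltnNge leq_addr /= addKn.
rewrite (nth_flatten3 (0, 0, 0)) //; last by move=> [[]].
case e: (nth _ _ m) => [[i j] k].
have : (i, j, k) \in tris by rewrite -e mem_nth.
rewrite mem_tris => /and5P[h1 h2 h3 _ _].
by case: r hr => [|[|[|]]] //= _; rewrite /cmid !modn_small ?(@minnmaxn_lt i j)
 ?(@minnmaxn_lt i k) ?(@minnmaxn_lt j k) //; lia.
Qed.

Lemma arr_index a b c : tri a b c -> exists m r,
  [/\ m < size tris, r < 3, arr a b c = 2 * n + (3 * m + r)
    & rot3 (nth (0, 0, 0) tris m) r = (a %% n, b %% n, c %% n)].
Proof.
move=> /tri_rot3[i [j [k [r [ht hr e]]]]].
exists (index (i, j, k) tris), r; rewrite index_mem nth_index //; split=> //.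
move: ht; rewrite mem_tris => /and5P[h1 h2 _ _ _].
by have := arr3_rot h1 h2 hr; rewrite e /=.
Qed.

Lemma index_arr m r : m < size tris -> r < 3 ->
  exists a b c, [/\ a < n, tri a b c, 2 * n + (3 * m + r) = arr a b c
    & rot3 (nth (0, 0, 0) tris m) r = (a %% n, b %% n, c %% n)].
Proof.
move=> hm hr; case e: (nth _ _ m) => [[i j] k].
have ht : (i, j, k) \in tris by rewrite -e mem_nth.
have [a [b [c [ha h e2]]]] := rot3_tri ht hr.
exists a, b, c; split=> //.
move: ht; rewrite mem_tris => /and5P[h1 h2 _ _ _].
by have := arr3_rot h1 h2 hr; rewrite e2 /= -e index_uniq ?uniq_tris.
Qed.

Lemma cmid_modl a b : cmid (a %% n) (b %% n) = cmid a b.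
Proof. by apply: cmid_mod; rewrite modn_mod. Qed.

Lemma arr_arrow a b c : tri a b c ->
  [/\ 2 * n <= arr a b c < size (qarr Q), src Q (arr a b c) = cmid a b
    & tgt Q (arr a b c) = cmid a c].
Proof.
move=> /arr_index[m [r [hm hr -> e]]].
have := nth_tri_arrow hm hr; rewrite e !cmid_modl /src /tgt => ->.
by rewrite size_qarr; split=> //; lia.
Qed.

Lemma arr_corner a b c : tri a b c -> nth 0 (tri_corners n T) (arr a b c - 2 * n) = a %% n.
Proof.
move=> /arr_index[m [r [hm hr -> e]]].
rewrite addKn (nth_flatten3 (0, 0, 0)) //; last by move=> [[]].
by move: e; case: (nth _ _ m) => [[i j] k]; case: r hr => [|[|[|]]] //= _ [].
Qed.

Lemma arr_other x : 2 * n <= x < size (qarr Q) ->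
  exists a b c, [/\ a < n, tri a b c & x = arr a b c].
Proof.
rewrite size_qarr => h.
have [a [b [c [ha t e _]]]] := @index_arr ((x - 2 * n) %/ 3) ((x - 2 * n) %% 3) (ltac:(lia)) (ltac:(lia)).
by exists a, b, c; split=> //; rewrite -e; lia.
Qed.

(** At a fixed corner the source determines [b], and the triangle following [ab] is unique. *)
Lemma arr_inj a b c b' c' : tri a b c -> tri a b' c' -> arr a b c = arr a b' c' -> b = b' /\ c = c'.
Proof.
move=> t t' e.
have [_ s1 _] := arr_arrow t; have [_ s2 _] := arr_arrow t'.
have [l1 l2 l3] := tri_lt t; have [l1' l2' l3'] := tri_lt t'.
have [c1 _ _] := tri_chord t; have [c2 _ _] := tri_chord t'.
have eb : b = b' by apply: (@cmid_inj_corner a) => //; try lia; rewrite -s1 -s2 e.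
by subst b'; split=> //; apply: tri_uniq t t'.
Qed.

(** The black face passes the corners [a], [c], [b] clockwise, which fixes what follows an arrow on
    it. *)
Lemma neg_rest a b c : tri a b c -> exists2 F, F \in neg_faces n T &
  arr a b c \in F /\ rest F (arr a b c) = [:: arr c a b; arr b c a].
Proof.
move=> /arr_index[m [r [hm hr -> e]]].
exists [:: 2 * n + 3 * m; 2 * n + 3 * m + 1; 2 * n + 3 * m + 2].
  by apply/mapP; exists m => //; rewrite mem_iota.
have : nth (0, 0, 0) tris m \in tris by rewrite mem_nth.
move: e (index_uniq (0, 0, 0) hm uniq_tris); rewrite /arr.
case: (nth _ _ m) => [[i j] k] /= e ei; rewrite mem_tris => /and5P[h1 h2 _ _ _].
have a0 := @arr3_rot i j k 0 h1 h2 isT.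
have a1 := @arr3_rot i j k 1 h1 h2 isT.
have a2 := @arr3_rot i j k 2 h1 h2 isT.
rewrite /= ei in a0 a1 a2.
case: r hr e => [|[|[|]]] //= _ [<- <- <-]; rewrite ?a0 ?a1 ?a2 !inE /rest /= ?addn0 ?addnA
 ?eqxx ?orbT /=; split=> //; repeat case: eqP => //=; lia.
Qed.

Lemma neg_rest_uniq a b c F : tri a b c -> F \in neg_faces n T -> arr a b c \in F ->
  rest F (arr a b c) = [:: arr c a b; arr b c a].
Proof.
move=> t; have [G hG [aG <-]] := neg_rest t; move: hG aG.
move=> /mapP[m _ ->] h1 /mapP[m' _ ->] h2.
suff -> : m = m' by [].
by move: h1 h2; rewrite !inE; lia.
Qed.

(** * Fans of triangle arrows around a polygon vertex *)

Fixpoint fan_fuel (m a b c : nat) : seq nat :=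
  if m is m'.+1 then
    if b < c then arr a b (nextn a b) :: fan_fuel m' a (nextn a b) c else [::]
  else [::].

(* The arrows at the corner [a] from the midpoint of the chord [ab] to that of the chord [ac]. *)
Definition fan (a b c : nat) : seq nat := fan_fuel (c - b) a b c.

(** Every arrow of the fan advances [b] by at least one, so [c - b] bounds the number of steps. *)
Lemma fan_fuelE m m' a b c : c - b <= m -> c - b <= m' -> fan_fuel m a b c = fan_fuel m' a b c.
Proof.
elim: m m' b => [|m IH] [|m'] b h h' //=; try by rewrite ifF //; lia.
by case: ifP => // hb; congr (_ :: _); apply: IH; rewrite /nextn; lia.
Qed.

Lemma fan_nil a b : fan a b b = [::].
Proof. by rewrite /fan subnn. Qed.

Lemma fan_cons a b k c : tri a b k -> k <= c -> fan a b c = arr a b k :: fan a k c.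
Proof.
move=> t kc; have [l1 l2 l3] := tri_lt t.
rewrite {1}/fan; have -> : c - b = (c - b).-1.+1 by lia.
rewrite /= (nextnE t) ifT; last lia.
by congr (_ :: _); apply: fan_fuelE; lia.
Qed.

(** Induction along the chords at [a], backwards from [ac]. The chord following [ab] cannot jump
    over [ac], by [tri_gap], so the steps reach [c] exactly. *)
Lemma fan_ind (P : nat -> Prop) a c : chord a c -> c < a + n -> P c ->
  (forall b k, tri a b k -> k <= c -> P k -> P b) ->
  forall b, a < b -> b <= c -> chord a b -> P b.
Proof.
move=> sac hc P0 PS b; have [m] := ubnP (c - b); elim: m b => // m IH b hm ab bc sab.
move: bc; rewrite leq_eqVlt => /orP[/eqP ->//|bc].
have [k t] := chord_next ab (ltac:(lia) : b.+1 < a + n) sab.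
have [l1 l2 l3] := tri_lt t; have [s1 s2 s3] := tri_chord t.
have kc : k <= c.
  by case: leqP => // ck; have := tri_gap t bc ck; rewrite sac.
by apply: (PS _ _ t kc); apply: IH => //; lia.
Qed.

Lemma fan_cat a b c d : a < b -> b <= c -> c <= d -> d < a + n ->
  chord a b -> chord a c -> fan a b d = fan a b c ++ fan a c d.
Proof.
move=> ab bc cd da sb sc; move: b ab bc sb; apply: fan_ind => //; first lia.
  by rewrite fan_nil.
move=> b k t kc IH; rewrite (fan_cons t kc) (fan_cons t); last lia.
by rewrite IH.
Qed.

Lemma fan_one a b c : tri a b c -> fan a b c = [:: arr a b c].
Proof. by move=> t; rewrite (fan_cons t) // fan_nil. Qed.

Lemma fan_rcons a b c d : a < b -> b <= c -> chord a b -> tri a c d ->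
  fan a b d = rcons (fan a b c) (arr a c d).
Proof.
move=> ab bc sb t; have [l1 l2 l3] := tri_lt t; have [s1 s2 s3] := tri_chord t.
by rewrite (@fan_cat a b c d) ?(fan_one t) ?cats1 //; lia.
Qed.

Lemma nextn_shift q a b : nextn (q * n + a) (q * n + b) = q * n + nextn a b.
Proof.
rewrite /nextn -addnS iotaDl find_map addnA; congr (_ + _).
by apply: eq_find => x /=; rewrite /chord !modnMDl.
Qed.

Lemma fan_shift q a b c : fan (q * n + a) (q * n + b) (q * n + c) = fan a b c.
Proof.
rewrite /fan subnDl; move: (c - b) => m; elim: m b => //= m IH b.
by rewrite ltn_add2l nextn_shift IH arr_shift.
Qed.

Lemma mem_fan a b c x : a < b -> b <= c -> c < a + n -> chord a b -> chord a c ->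
  reflect (exists b' c', [/\ tri a b' c', b <= b', c' <= c & x = arr a b' c']) (x \in fan a b c).
Proof.
move=> ab bc ca sb sc; apply: (iffP idP); last first.
  move=> [b' [c' [t l1 l2 ->]]]; have [k1 k2 k3] := tri_lt t; have [s1 s2 s3] := tri_chord t.
  by rewrite (@fan_cat a b b' c) ?(fan_cons t) ?mem_cat ?inE ?eqxx ?orbT //; lia.
move: b ab bc sb; apply: fan_ind => //; first by rewrite fan_nil.
move=> b k t kc IH; rewrite (fan_cons t kc) inE => /orP[/eqP ->|/IH].
  by exists b, k.
have [k1 k2 k3] := tri_lt t.
by move=> [b' [c' [t' l1 l2 ->]]]; exists b', c'; split=> //; lia.
Qed.

Lemma fan_uniq a b c : a < b -> b <= c -> c < a + n -> chord a b -> chord a c -> uniq (fan a b c).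
Proof.
move=> ab bc ca sb sc; move: b ab bc sb; apply: fan_ind => //; first by rewrite fan_nil.
move=> b k t kc IH; rewrite (fan_cons t kc) /= IH andbT.
have [k1 k2 k3] := tri_lt t; have [s1 s2 s3] := tri_chord t.
apply/negP => /mem_fan[] //; first lia.
by move=> b' [c' [t' l1 _ /(arr_inj t t')[]]]; lia.
Qed.

Lemma fan_path a b c : a < b -> b <= c -> c < a + n -> chord a b -> chord a c ->
  chain Q (cmid a b) (fan a b c) /\ pend Q (cmid a b, fan a b c) = cmid a c.
Proof.
move=> ab bc ca sb sc; move: b ab bc sb; apply: fan_ind => //; first by rewrite fan_nil.
move=> b k t kc [IH1 IH2]; rewrite (fan_cons t kc) pend_cons /=.
by have [/andP[_ ->] -> ->] := arr_arrow t; rewrite eqxx.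
Qed.

(** * Boundary arrows and the white faces *)

Lemma bnd_arrow x : x < 2 * n ->
  [/\ x < size (qarr Q), src Q x = (x + 2 * n - 1) %% (2 * n) & tgt Q x = x].
Proof.
move=> h; rewrite size_qarr /src /tgt /= nth_cat size_bnd h.
rewrite (nth_map 0) ?size_iota // nth_iota //= /lab.
split; first lia.
- have -> : 1 + x + 2 * n - 1 + 2 * n - 1 = (x + 2 * n - 1) + 2 * n by lia.
  by rewrite modnDr.
- have -> : 1 + x + 2 * n - 1 = x + 2 * n by lia.
  by rewrite modnDr modn_small.
Qed.

Lemma mem_corner_arrows p x : p < n -> (x \in corner_arrows n T p) <->
  [\/ x = 2 * p + 1, x = 2 * p | exists b c, tri p b c /\ x = arr p b c].
Proof.
move=> hp; rewrite !inE; split.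
  case/or3P => [/eqP ->|/eqP ->|]; [by constructor 1|by constructor 2|].
  case/mapP => q; rewrite mem_filter mem_iota => /andP[/eqP cq /andP[_ hq]] ->.
  have hs : 2 * n <= 2 * n + q < size (qarr Q).
    move: hq; rewrite size_qarr size_flatten3; last by move=> [[]].
    by rewrite leq_addr ltn_add2l.
  have [a [b [c [ha t e]]]] := arr_other hs.
  have := arr_corner t; rewrite -e addKn cq modn_small // => ea.
  by constructor 3; exists b, c; rewrite ea.
case=> [->|->|[b [c [t ->]]]]; rewrite ?eqxx ?orbT //.
apply/orP; right; apply/orP; right; apply/mapP; exists (arr p b c - 2 * n).
  rewrite mem_filter mem_iota (arr_corner t) modn_small // eqxx /=.
  have [/andP[lo hi] _ _] := arr_arrow t; rewrite add0n ltn_subLR //.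
  by rewrite size_flatten3 -?size_qarr // => -[[]].
by have [/andP[lo _] _ _] := arr_arrow t; rewrite subnKC.
Qed.

Lemma uniq_corner_arrows p : p < n -> uniq (corner_arrows n T p).
Proof.
move=> hp; rewrite [uniq _]/= inE map_inj_uniq; last exact: addnI.
rewrite filter_uniq ?iota_uniq // andbT negb_or.
apply/andP; split; first (apply/andP; split; first lia).
  by apply/mapP => -[q _]; lia.
by apply/mapP => -[q _]; lia.
Qed.

Lemma chord_last a : chord a (a + n.-1).
Proof.
rewrite chordC -(chord_mod (erefl _) (modnDr a n)).
have -> : a + n = (a + n.-1).+1 by lia.
exact: chord_succ.
Qed.

(** The full fan, from the midpoint of the side after [p] to that of the side before it; this is the
    image of the arrow z at [p]. *)
Definition fan_all (p : nat) : seq nat := fan p p.+1 (p + n.-1).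

Lemma mem_fan_all p x :
  reflect (exists b c, tri p b c /\ x = arr p b c) (x \in fan_all p).
Proof.
apply: (iffP (mem_fan _ _ _ _ _ _)); try lia.
- exact: chord_succ.
- exact: chord_last.
- by move=> [b [c [t _ _ ->]]]; exists b, c.
- move=> [b [c [t ->]]]; exists b, c; have [] := tri_lt t.
  by split=> //; lia.
Qed.

Lemma cmid_neq_corner a b p : p < n -> a < b -> b < a + n -> cmid a b <> 2 * p.
Proof.
move=> hp h1 h2 e.
have [hb|hb] := cmid_boundary h1 h2 (ltac:(lia) : cmid a b < 2 * n).
  by move: e; rewrite hb cmid_succ; lia.
move: e; rewrite hb cmid_pred; have := ltn_pmod a (ltnW (ltnW n3)).
move: (a %% n) => r hr; case: r hr => [|r] hr.
  by rewrite modn_small; lia.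
have -> : 2 * r.+1 + 2 * n - 1 = (2 * r + 1) + 2 * n by lia.
by rewrite modnDr modn_small; lia.
Qed.

(** The arrow [2 * p + 1] starts at the corner component, [2 * p] at the midpoint of the side before
    [p], and a triangle arrow at the midpoint of any other chord at [p]. This is the distinctness
    that [walk_path] needs. *)
Lemma corner_src_inj p : p < n -> {in corner_arrows n T p &, injective (src Q)}.
Proof.
move=> hp x y /mem_corner_arrows-/(_ hp) hx /mem_corner_arrows-/(_ hp) hy.
have s1 : src Q (2 * p + 1) = 2 * p.
  have [_ -> _] := @bnd_arrow (2 * p + 1) (ltac:(lia)).
  have -> : 2 * p + 1 + 2 * n - 1 = 2 * p + 2 * n by lia.
  by rewrite modnDr modn_small; lia.
have s2 : src Q (2 * p) = cmid p (p + n.-1).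
  have [_ -> _] := @bnd_arrow (2 * p) (ltac:(lia)).
  by rewrite cmid_pred (modn_small hp).
have n2 a b c : tri a b c -> cmid a b <> 2 * p.
  by move=> /tri_lt[l1 l2 l3]; apply: cmid_neq_corner => //; lia.
have n4 : cmid p (p + n.-1) <> 2 * p by apply: cmid_neq_corner => //; lia.
have n5 b c : tri p b c -> cmid p b <> cmid p (p + n.-1).
  move=> t e; have [l1 l2 l3] := tri_lt t; have [c1 _ _] := tri_chord t.
  have := cmid_inj_corner _ _ _ _ c1 (chord_last p) e; lia.
have s3 b c : tri p b c -> src Q (arr p b c) = cmid p b by move=> /arr_arrow[].
case: hx hy => [->|->|[b [c [t ->]]]] [->|->|[b' [c' [t' ->]]]];
  rewrite ?s1 ?s2 ?(s3 _ _ t) ?(s3 _ _ t') // => e.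
- by have := n4 (esym e).
- by have := n2 _ _ _ t' (esym e).
- by have := n5 _ _ t' (esym e).
- by have := n2 _ _ _ t e.
- by have := n5 _ _ t e.
- have [l1 l2 l3] := tri_lt t; have [c1 _ _] := tri_chord t.
  have [l1' l2' l3'] := tri_lt t'; have [c1' _ _] := tri_chord t'.
  have eb : b = b' by apply: cmid_inj_corner c1 c1' e; lia.
  by rewrite eb in t *; rewrite (tri_uniq t t').
Qed.

Lemma fan_linked a b c x y : a < b -> b <= c -> c < a + n -> chord a b -> chord a c ->
  tgt Q x = cmid a b -> src Q y = cmid a c ->
  path (fun x y => tgt Q x == src Q y) x (rcons (fan a b c) y).
Proof.
move=> ab bc ca sb sc hx hy; move: b ab bc sb x hx; apply: fan_ind => //.
  by move=> x hx; rewrite fan_nil /= hx hy eqxx.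
move=> b k t kc IH x hx; rewrite (fan_cons t kc) /=.
have [_ -> e] := arr_arrow t.
by rewrite hx eqxx IH.
Qed.

(** The white face leaves the corner component along the next side, turns through the full fan and
    returns. This cycle has the same arrows as [corner_arrows], each once, so [walk] must follow
    it. *)
Lemma pos_faceE p : p < n ->
  walk Q (corner_arrows n T p) (2 * p + 1) (size (corner_arrows n T p)) =
  2 * p + 1 :: rcons (fan_all p) (2 * p).
Proof.
move=> hp; set F := _ :: _.
have eF : corner_arrows n T p =i F.
  move=> x; apply/idP/idP.
    rewrite [x \in F]inE mem_rcons [_ \in _ :: _]inE.
    case/(mem_corner_arrows _ hp) => [->|->|/mem_fan_all ->]; rewrite ?eqxx ?orbT //.
  rewrite [x \in F]inE mem_rcons [_ \in _ :: _]inE => /or3P[/eqP ->|/eqP ->|/mem_fan_all h];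
    apply/(mem_corner_arrows _ hp); [by constructor 1|by constructor 2|by constructor 3].
have fb x : x \in fan_all p -> 2 * n <= x.
  by case/mem_fan_all => b [c [t ->]]; have [/andP[]] := arr_arrow t.
have uF : uniq F.
  rewrite /F /= mem_rcons inE rcons_uniq fan_uniq; try lia.
  - rewrite andbT negb_or -andbA; apply/and3P; split; first lia.
      by apply/negP => /fb; lia.
    by apply/negP => /fb; lia.
  - exact: chord_succ.
  - exact: chord_last.
have -> : size (corner_arrows n T p) = size F.
  by apply: perm_size; apply: uniq_perm => //; exact: uniq_corner_arrows.
apply: walk_path; first exact: corner_src_inj.
  by apply/allP => x; rewrite -eF.
apply: fan_linked; try lia.
- exact: chord_succ.
- exact: chord_last.
- have [_ _ ->] := @bnd_arrow (2 * p + 1) (ltac:(lia)).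
  by rewrite cmid_succ modn_small.
- have [_ -> _] := @bnd_arrow (2 * p) (ltac:(lia)).
  by rewrite cmid_pred (modn_small hp).
Qed.

(* Complement of the arrow [arr a b c] in the white face at its corner. *)
Definition corner_rest (a b c : nat) : seq nat :=
  fan a c (a + n.-1) ++ [:: 2 * (a %% n); 2 * (a %% n) + 1] ++ fan a a.+1 b.

Lemma pos_rest p b c : p < n -> tri p b c ->
  rest (2 * p + 1 :: rcons (fan_all p) (2 * p)) (arr p b c) = corner_rest p b c.
Proof.
move=> hp t; have [l1 l2 l3] := tri_lt t; have [s1 s2 s3] := tri_chord t.
have [/andP[lo _] _ _] := arr_arrow t.
rewrite /fan_all (@fan_cat p p.+1 b); try lia; rewrite ?chord_succ //.
rewrite (@fan_cons p b c) //; last lia.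
have nin : arr p b c \notin fan p p.+1 b.
  apply/negP => /mem_fan[]; try lia; rewrite ?chord_succ //.
  by move=> b' [c' [t' _ k /(arr_inj t t')[eb _]]]; have [] := tri_lt t'; lia.
rewrite /rest /= ifN_eq ?eqn_leq; last lia.
rewrite -cats1 -catA index_cat (negbTE nin) /= eqxx addn0.
rewrite -[in drop _ _]cat_cons drop_cat ifN; last by rewrite /=; lia.
rewrite subSn // subnn /= drop0 take_size_cat // -catA /=.
by rewrite /corner_rest (modn_small hp).
Qed.

Lemma fan_all_shift q a : fan_all (q * n + a) = fan_all a.
Proof. by rewrite /fan_all -addnS -addnA fan_shift. Qed.

Lemma fan_all_mod a : fan_all (a %% n) = fan_all a.
Proof. by rewrite {2}(divn_eq a n) fan_all_shift. Qed.

Lemma corner_rest_shift q a b c :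
  corner_rest (q * n + a) (q * n + b) (q * n + c) = corner_rest a b c.
Proof. by rewrite /corner_rest modnMDl -addnA -addnS !fan_shift. Qed.

(** * The relations of the dimer algebra and their weights *)

Let D := DT n T.

Let R := dimer_trips D.

Lemma neg_face_ge F x : F \in neg_faces n T -> x \in F -> 2 * n <= x < size (qarr Q).
Proof.
rewrite size_qarr => /mapP[m]; rewrite mem_iota => hm ->.
have {}hm : m < size tris by [].
by rewrite !inE; lia.
Qed.

Lemma pos_facesP F : reflect (exists2 p, p < n & F = 2 * p + 1 :: rcons (fan_all p) (2 * p))
  (F \in pos_faces n T).
Proof.
apply: (iffP mapP) => -[p]; rewrite ?mem_iota ?add0n => hp ->; exists p => //.
- exact: pos_faceE.
- by rewrite mem_iota add0n.
- by rewrite -pos_faceE.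
Qed.

(** The internal arrows are the triangle arrows. Each lies on one white and one black face, so there
    is one relation for each corner of each triangle. *)
Lemma mem_dimer_trips s u v : (s, u, v) \in R <-> exists p b c,
  [/\ p < n, tri p b c, s = cmid p c, u = corner_rest p b c & v = [:: arr c p b; arr b c p]].
Proof.
split.
  case/flatten_mapP=> x _ /flatten_mapP[F]; rewrite mem_filter => /andP[xF /pos_facesP[p hp eF]].
  case/mapP=> G; rewrite mem_filter => /andP[xG hG] [-> -> ->].
  have hx := neg_face_ge hG xG.
  have [b [c [t ex]]] : exists b c, tri p b c /\ x = arr p b c.
    apply/mem_fan_all; move: xF; rewrite eF inE mem_rcons inE.
    by case/or3P => // /eqP ex; move: hx; lia.
  exists p, b, c; split=> //; first by rewrite ex; have [] := arr_arrow t.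
    by rewrite eF ex pos_rest.
  by rewrite ex in xG *; apply: neg_rest_uniq.
move=> [p [b [c [hp t -> -> ->]]]].
have [/andP[lo hi] _ tg] := arr_arrow t.
apply/flatten_mapP; exists (arr p b c); first by rewrite mem_iota.
apply/flatten_mapP; exists (2 * p + 1 :: rcons (fan_all p) (2 * p)).
  rewrite mem_filter; apply/andP; split; last by apply/pos_facesP; exists p.
  by rewrite inE mem_rcons inE; apply/or3P/Or33/mem_fan_all; exists b, c.
have [G hG [aG eG]] := neg_rest t.
by apply/mapP; exists G; rewrite ?mem_filter ?aG // eG pos_rest // tg.
Qed.

Lemma dimer_trip a b c : tri a b c ->
  (cmid a c, corner_rest a b c, [:: arr c a b; arr b c a]) \in R.
Proof.
have [q [p [-> hp]]] := lift_reduce a => t; have [h1 h2 h3] := tri_lt t.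
have [b' eb] := @lift_from q _ (ltac:(lia) : q * n <= b).
have [c' ec] := @lift_from q _ (ltac:(lia) : q * n <= c).
move: t; rewrite eb ec tri_shift corner_rest_shift !arr_shift => t.
apply/mem_dimer_trips; exists p, b', c'; split=> //.
by apply: cmid_mod; rewrite modnMDl.
Qed.

(** By the inscribed angle theorem the angle at a corner, in units of pi/n, is the number of polygon
    sides on the opposite arc. The corners are listed in the order of [tri_corners]. *)
Definition wt (x : nat) : nat :=
  if x < 2 * n then 1 else
  let: (i, j, k) := nth (0, 0, 0) tris ((x - 2 * n) %/ 3) in
  nth 0 [:: k - j; j - i; n - k + i] ((x - 2 * n) %% 3).

Lemma sub_mod b c : b < c -> c < b + n ->
  c - b = if b %% n < c %% n then c %% n - b %% n else n + c %% n - b %% n.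
Proof.
have [q [r [-> hr]]] := lift_reduce b => h1 h2.
have [c' ec] := @lift_from q _ (ltac:(lia) : q * n <= c).
rewrite ec !modnMDl subnDl !mod_wrap; try lia.
by case: (ltnP r n); case: (ltnP c' n); case: ifP; lia.
Qed.

Lemma wt_arr a b c : tri a b c -> wt (arr a b c) = c - b.
Proof.
move=> t; have [l1 l2 l3] := tri_lt t; rewrite (sub_mod l2); last lia.
have [m [r [hm hr -> e]]] := arr_index t.
have : nth (0, 0, 0) tris m \in tris by rewrite mem_nth.
rewrite /wt ltnNge leq_addr /= addKn.
have -> : (3 * m + r) %/ 3 = m by lia.
have -> : (3 * m + r) %% 3 = r by lia.
move: e; case: (nth _ _ m) => [[i j] k] e; rewrite mem_tris => /and5P[h1 h2 h3 _ _].
by case: r hr e => [|[|[|]]] //= _ [_ <- <-]; case: ifP; lia.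
Qed.

Lemma wsum_fan a b c : a < b -> b <= c -> c < a + n -> chord a b -> chord a c ->
  wsum wt (fan a b c) = c - b.
Proof.
move=> ab bc ca sb sc; move: b ab bc sb; apply: fan_ind => //.
  by rewrite fan_nil subnn.
move=> b k t kc IH; rewrite (fan_cons t kc) /wsum /= -/(wsum _ _) IH (wt_arr t).
by have [] := tri_lt t; lia.
Qed.

Lemma arrow_corner_left a b c : tri a b c ->
  let x := arr c a b in [/\ x < size (qarr Q), src Q x = cmid a c, tgt Q x = cmid b c & wt x = b - a].
Proof.
move=> t /=; have t2 := tri_rot (tri_rot t).
have -> : arr c a b = arr c (a + n) (b + n) by apply: arr_mod; rewrite ?modnDr.
have [/andP[_ ->] -> ->] := arr_arrow t2; rewrite (wt_arr t2) subnDr; split=> //.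
- by rewrite cmidC; apply: cmid_mod; rewrite ?modnDr.
- by rewrite cmidC; apply: cmid_mod; rewrite ?modnDr.
Qed.

Lemma arrow_corner_mid a b c : tri a b c ->
  let x := arr b c a in [/\ x < size (qarr Q), src Q x = cmid b c, tgt Q x = cmid a b & wt x = a + n - c].
Proof.
move=> t /=; have t2 := tri_rot t.
have -> : arr b c a = arr b c (a + n) by apply: arr_mod; rewrite ?modnDr.
have [/andP[_ ->] -> ->] := arr_arrow t2; rewrite (wt_arr t2); split=> //.
by rewrite cmidC; apply: cmid_mod; rewrite ?modnDr.
Qed.

Lemma wt_bnd x : x < 2 * n -> wt x = 1.
Proof. by rewrite /wt => ->. Qed.

Lemma corner_turn a : let p := a %% n in
  [/\ chain Q (cmid a (a + n.-1)) [:: 2 * p; 2 * p + 1],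
      pend Q (cmid a (a + n.-1), [:: 2 * p; 2 * p + 1]) = cmid a a.+1
    & wsum wt [:: 2 * p; 2 * p + 1] = 2].
Proof.
move=> /=; have hp := ltn_pmod a (ltnW (ltnW n3)); rewrite cmid_pred cmid_succ.
move: (a %% n) hp => p hp.
have [b1 s1 t1] := @bnd_arrow (2 * p) (ltac:(lia)).
have [b2 s2 t2] := @bnd_arrow (2 * p + 1) (ltac:(lia)).
rewrite /wsum /= !wt_bnd; try lia.
rewrite b1 s1 t1 b2 s2 eqxx /=; split=> //.
have -> : 2 * p + 1 + 2 * n - 1 = 2 * p + 2 * n by lia.
by rewrite modnDr modn_small; lia.
Qed.

(** White and black faces all have weight n: a full fan has n - 2 and two boundary arrows add 2,
    while the angles of a triangle sum to n. Removing the common arrow leaves equal weights. *)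
Lemma homog_dimer : homog Q R wt.
Proof.
move=> s u v /mem_dimer_trips[p [b [c [hp t -> -> ->]]]].
have [l1 l2 l3] := tri_lt t; have [s1 s2 s3] := tri_chord t.
have [x1 x2 x3 x4] := arrow_corner_left t; have [y1 y2 y3 y4] := arrow_corner_mid t.
have [c1 c2 c3] := corner_turn p.
have [f1 f2] := @fan_path p c (p + n.-1) (ltac:(lia)) (ltac:(lia)) (ltac:(lia)) s3 (chord_last p).
have [g1 g2] := @fan_path p p.+1 b (ltac:(lia)) l1 (ltac:(lia)) (chord_succ p) s1.
split.
- by rewrite /corner_rest !chain_cat f1 f2 c1 c2.
- by rewrite /= x1 x2 x3 y1 y2 !eqxx.
- by rewrite /corner_rest !pend_cat f2 c2 g2 /pend /= y3.
- rewrite /corner_rest !wsum_cat c3 !wsum_fan ?chord_last ?chord_succ //; try lia.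
  by rewrite /wsum /= x4 y4; lia.
Qed.

(** * Boundary paths and products of two fans *)

Definition xpath (s m : nat) : seq nat := [seq (s + 1 + j) %% (2 * n) | j <- iota 0 m].

Lemma xpathD s m1 m2 : xpath s (m1 + m2) = xpath s m1 ++ xpath (s + m1) m2.
Proof.
rewrite /xpath iotaD map_cat; congr (_ ++ _).
have -> : iota (0 + m1) m2 = [seq m1 + j | j <- iota 0 m2] by rewrite -iotaDl addnC.
by rewrite -map_comp; apply: eq_map => j /=; congr (_ %% _); lia.
Qed.

Lemma xpath_mod s s' m : s = s' %[mod 2 * n] -> xpath s m = xpath s' m.
Proof.
by move=> e; apply: eq_map => j; rewrite -!addnA -modnDml e modnDml.
Qed.

Lemma double_mod a : 2 * a %% (2 * n) = 2 * (a %% n).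
Proof. by rewrite -muln_modr. Qed.

Lemma odd_mod a : (2 * a + 1) %% (2 * n) = 2 * (a %% n) + 1.
Proof.
rewrite -modnDml double_mod modn_small //.
by have := ltn_pmod a (ltnW (ltnW n3)); move: (a %% n); lia.
Qed.

(** These two arrows pass the corner [a], from the midpoint of the side before it to that of the
    side after it. *)
Lemma xpath2 a : xpath (2 * a + 2 * n - 1) 2 = [:: 2 * (a %% n); 2 * (a %% n) + 1].
Proof.
rewrite /xpath /= -odd_mod -double_mod.
have -> : 2 * a + 2 * n - 1 + 1 + 0 = 2 * a + 2 * n by lia.
have -> : 2 * a + 2 * n - 1 + 1 + 1 = 2 * a + 1 + 2 * n by lia.
by rewrite !modnDr.
Qed.

Lemma xpathS s m : xpath s m.+1 = (s + 1) %% (2 * n) :: xpath (s + 1) m.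
Proof. by rewrite -add1n xpathD /xpath /= addn0. Qed.

Lemma xpath_in (P : quiver) s m :
  (forall x, x < 2 * n -> [/\ x < size (qarr P), src P x = (x + 2 * n - 1) %% (2 * n) & tgt P x = x]) ->
  chain P (s %% (2 * n)) (xpath s m) /\ pend P (s %% (2 * n), xpath s m) = (s + m) %% (2 * n).
Proof.
move=> hP; elim: m s => [|m IH] s; first by rewrite addn0.
rewrite xpathS pend_cons /=.
have [-> -> ->] := hP _ (@ltn_pmod (s + 1) (2 * n) (ltac:(lia))).
have [-> ->] := IH (s + 1); split; last by rewrite -addnA.
rewrite andbT -addnBA; last lia.
rewrite modnDml; have -> : s + 1 + (2 * n - 1) = s + 2 * n by lia.
by rewrite modnDr eqxx.
Qed.

(* The black face of the triangle [akb] turns the path along its sides [ak], [ab], [bk] into one around [k]. *)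
Lemma fan_turn a k b : tri a k b -> peqv Q R (cmid a a.+1)
  (fan a a.+1 b ++ [:: arr b (a + n) (k + n)])
  ((fan a a.+1 k ++ fan k (a + n) (k + n.-1)) ++ xpath (2 * k + 2 * n - 1) 2 ++ fan k k.+1 b).
Proof.
move=> t; have [l1 l2 l3] := tri_lt t; have [s1 s2 s3] := tri_chord t.
rewrite (fan_rcons _ _ (chord_succ a) t) // -cats1 -!catA xpath2.
have em : pend Q (cmid a a.+1, fan a a.+1 k) = cmid k (a + n).
  have [_ ->] := @fan_path a a.+1 k (ltac:(lia)) l1 (ltac:(lia)) (chord_succ a) s1.
  by rewrite cmidC; apply: cmid_mod; rewrite ?modnDr.
have e1 : arr (a + n) k b = arr a k b by apply: arr_mod; rewrite ?modnDr.
have e2 : arr b (a + n) (k + n) = arr b (a + n) k by apply: arr_mod; rewrite ?modnDr.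
have rl := dimer_trip (tri_rot t); rewrite e1 -e2 in rl.
by apply/peqv_catl/Peqv_sym; rewrite em; apply: peqv_rel.
Qed.

Lemma xpath_turn a k : a < k ->
  xpath (2 * a + 1) (2 * (k - a)) = xpath (2 * a + 1) (2 * (k - a.+1)) ++ xpath (2 * k + 2 * n - 1) 2.
Proof.
move=> ak; have -> : 2 * (k - a) = 2 * (k - a.+1) + 2 by lia.
rewrite (xpathD _ (2 * (k - a.+1)) 2); congr (_ ++ _).
by apply: xpath_mod; rewrite -(modnDr (_ + _)); congr (_ %% _); lia.
Qed.

Lemma fan_fan a b : a < b -> b < a + n -> chord a b ->
  peqv Q R (cmid a a.+1) (fan a a.+1 b ++ fan b (a + n) (b + n.-1)) (xpath (2 * a + 1) (2 * (b - a.+1))).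
Proof.
have [m] := ubnP (b - a); elim: m a b => // m IH a b hm ab ba sab.
have [e|ab2] : b = a.+1 \/ a.+1 < b by lia.
  have -> : b + n.-1 = a + n by lia.
  by rewrite e subnn muln0 !fan_nil; exact: Peqv_refl.
have [k t] := chord_apex ab2 ba sab.
have [l1 l2 l3] := tri_lt t; have [s1 s2 s3] := tri_chord t.
(* The fan at [b] begins with the arrow of the triangle on [ab]. Trading it by [fan_turn] leaves two
   instances of the claim, for the shorter chords [ak] and [kb]. *)
rewrite (@fan_cons b (a + n) (k + n) _ (tri_rot (tri_rot t))); last lia.
rewrite -[_ :: _]cat1s catA.
apply: Peqv_trans (peqv_catr _ (fan_turn t)) _; rewrite -!catA.
(* The boundary path is cut into the part up to the side before [k], the two arrows past the corner
   [k], and the rest. *)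
have -> : xpath (2 * a + 1) (2 * (b - a.+1)) =
    xpath (2 * a + 1) (2 * (k - a.+1)) ++ xpath (2 * k + 2 * n - 1) 2 ++ xpath (2 * k + 1) (2 * (b - k.+1)).
  have -> : 2 * (b - a.+1) = 2 * (k - a) + 2 * (b - k.+1) by lia.
  rewrite (xpathD _ (2 * (k - a))) (xpath_turn l1) -catA; do 2 congr (_ ++ _).
  by congr (xpath _ _); lia.
rewrite catA; apply: Peqv_trans (peqv_catr _ (IH a k _ l1 _ s1)) _; try lia.
rewrite xpath2; apply: peqv_catl; apply: (@peqv_catl _ _ _ [:: _; _]).
have h : 2 * (k %% n) + 1 < 2 * n.
  by have := ltn_pmod k (ltnW (ltnW n3)); move: (k %% n); lia.
rewrite [pend Q (_, [:: _; _])]/pend /=; have [_ _ ->] := bnd_arrow h.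
by rewrite -cmid_succ; apply: IH => //; lia.
Qed.

(** * The algebra of Gamma(n) *)

Let G := Gamma n.
Arguments xpath : simpl never.

Ltac linlia := repeat match goal with H : context [modn _ _] |- _ => clear H end; lia.

(** In the labels of Gamma(n) this is z with index 2a + 2. It joins the midpoints of the two sides
    at the polygon vertex [a], from the side after to the side before. *)
Definition zarr (a : nat) : nat := 2 * n + a %% n.

Definition gamma_trips : seq (nat * seq nat * seq nat) :=
  flatten [seq [:: (lab n (2 * i),
                    [:: xa n (2 * i + 1); xa n (2 * i + 2); za n (i + 1)],
                    [:: za n i; xa n (2 * i + 2 * n - 1); xa n (2 * i)]);
                   (lab n (2 * i), [:: za n i; za n (i + n - 1)],
                    [seq xa n (2 * i + 1 + j) | j <- iota 0 (2 * n - 4)])]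
          | i <- iota 1 n].

Definition commute_trip (a : nat) : nat * seq nat * seq nat :=
  (2 * (a %% n) + 1, xpath (2 * a + 1) 2 ++ [:: zarr a.+1], zarr a :: xpath (2 * a + 2 * n - 1) 2).

Definition square_trip (a : nat) : nat * seq nat * seq nat :=
  (2 * (a %% n) + 1, [:: zarr a; zarr (a + n.-1)], xpath (2 * a + 1) (2 * n - 4)).

(** The relations numbered i belong to the polygon vertex p = i - 1; all index shifts between labels
    and numbers are settled here. *)
Lemma gamma_tripsE : gamma_trips =
  flatten [seq [:: commute_trip p; square_trip p] | p <- iota 0 n].
Proof.
rewrite /gamma_trips -[1]addn0 iotaDl -map_comp; congr flatten.
apply/eq_in_map => p; rewrite mem_iota => /andP[_ hp] /=.
rewrite /commute_trip /square_trip /lab /xa /za /zarr /xpath /= (modn_small hp).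
have e0 : (2 * (1 + p) + 2 * n - 1) %% (2 * n) = 2 * p + 1.
  rewrite (@modn_eq 1 _ _ (2 * p + 1)); last linlia.
  by rewrite modn_small //; lia.
have e1 : (1 + p + n - 1) %% n = p.
  rewrite (@modn_eq 1 _ _ p); last linlia.
  by rewrite modn_small.
rewrite e0 e1; congr [:: (_, [:: _; _; _ + _], [:: _; _; _]); (_, [:: _; _ + _], _)].
- by apply: (@modn_eq 1); linlia.
- by apply: (@modn_eq 1); linlia.
- by apply: (@modn_eq 1); linlia.
- by apply: (@modn_eq 1); linlia.
- by rewrite -e0; apply: (@modn_eq 0); linlia.
- by apply: (@modn_eq 1); linlia.
- by apply: eq_map => j; apply: (@modn_eq 1); linlia.
Qed.

Lemma mem_gamma_trips t : t \in gamma_trips <->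
  exists2 p, p < n & t = commute_trip p \/ t = square_trip p.
Proof.
rewrite gamma_tripsE; split.
  case/flatten_mapP=> p; rewrite mem_iota => /andP[_ hp]; rewrite !inE => h.
  by exists p => //; case/orP: h => /eqP ->; [left|right].
move=> [p hp h]; apply/flatten_mapP; exists p; first by rewrite mem_iota.
by rewrite !inE; case: h => ->; rewrite eqxx ?orbT.
Qed.

Lemma predn_modDl y : (y %% (2 * n) + 2 * n - 1) %% (2 * n) = (y + 2 * n - 1) %% (2 * n).
Proof.
have e x : x + 2 * n - 1 = x + (2 * n - 1) by lia.
by rewrite !e modnDml.
Qed.

Lemma commute_trip_in a : commute_trip a \in gamma_trips.
Proof.
apply/mem_gamma_trips; exists (a %% n); first by rewrite ltn_pmod //; lia.
left; rewrite /commute_trip /zarr modn_mod.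
rewrite (@xpath_mod (2 * (a %% n) + 1) (2 * a + 1)); last first.
  by rewrite -double_mod modnDml.
rewrite (@xpath_mod (2 * (a %% n) + 2 * n - 1) (2 * a + 2 * n - 1)); last first.
  by rewrite -double_mod predn_modDl.
by rewrite -[(a %% n).+1]addn1 -[a.+1]addn1 modnDml.
Qed.

Lemma square_trip_in a : square_trip a \in gamma_trips.
Proof.
apply/mem_gamma_trips; exists (a %% n); first by rewrite ltn_pmod //; lia.
right; rewrite /square_trip /zarr modn_mod modnDml.
by rewrite (@xpath_mod (2 * (a %% n) + 1) (2 * a + 1)) // -double_mod modnDml.
Qed.

Lemma size_gamma : size (qarr G) = 3 * n.
Proof. by rewrite /= size_cat size_bnd size_map size_iota; lia. Qed.

Lemma gamma_bnd x : x < 2 * n ->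
  [/\ x < size (qarr G), src G x = (x + 2 * n - 1) %% (2 * n) & tgt G x = x].
Proof.
move=> h; have [_ e1 e2] := bnd_arrow h; rewrite size_gamma; split; first lia.
- by rewrite -e1 /src /= !nth_cat size_bnd h.
- by rewrite -[RHS]e2 /tgt /= !nth_cat size_bnd h.
Qed.

Lemma gamma_z a : [/\ zarr a < size (qarr G), src G (zarr a) = 2 * (a %% n) + 1
  & tgt G (zarr a) = (2 * a + 2 * n - 1) %% (2 * n)].
Proof.
have hp := ltn_pmod a (ltnW (ltnW n3)).
have hz : (2 * n + a %% n < 2 * n) = false by rewrite ltnNge leq_addr.
rewrite size_gamma /src /tgt /zarr /= nth_cat size_bnd hz addKn.
rewrite (nth_map 0) ?size_iota // nth_iota //= /lab.
have -> : (2 * a + 2 * n - 1) %% (2 * n) = (2 * (a %% n) + 2 * n - 1) %% (2 * n).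
  by rewrite -double_mod predn_modDl.
move: (a %% n) hp => p hp; split; first lia.
- rewrite (@modn_eq 1 _ _ (2 * p + 1)); last linlia.
  by rewrite modn_small //; lia.
- rewrite (@modn_eq 1 _ _ (2 * p + 2 * n - 1)) //; lia.
Qed.

(** * Weights and normal forms in Gamma(n) *)

Definition gwt (x : nat) : nat := if x < 2 * n then 1 else n - 2.

Lemma wsum_xpath (w : nat -> nat) s m : (forall x, x < 2 * n -> w x = 1) -> wsum w (xpath s m) = m.
Proof.
move=> hw; rewrite /wsum /xpath -map_comp.
rewrite (eq_map (g := fun _ => 1)); last by move=> j /=; rewrite hw // ltn_pmod //; lia.
by rewrite -[RHS](size_iota 0 m); elim: (iota 0 m) => //= _ r ->.
Qed.

Lemma gwt_bnd x : x < 2 * n -> gwt x = 1.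
Proof. by rewrite /gwt => ->. Qed.

Lemma gwt_z a : gwt (zarr a) = n - 2.
Proof. by rewrite /gwt /zarr ltnNge leq_addr. Qed.

Lemma gamma_xpath s m :
  chain G (s %% (2 * n)) (xpath s m) /\ pend G (s %% (2 * n), xpath s m) = (s + m) %% (2 * n).
Proof. exact: xpath_in gamma_bnd. Qed.

Lemma homog_gamma : homog G gamma_trips gwt.
Proof.
move=> s u v /mem_gamma_trips[p hp [] e];
  move: (congr1 (fun t => t.1.1) e) (congr1 (fun t => t.1.2) e) (congr1 snd e);
  rewrite /commute_trip /square_trip ![(_, _).1]/fst ![(_, _).2]/snd => -> -> {e}->;
  have [z1 z2 z3] := gamma_z p.
  have [y1 y2 y3] := gamma_z p.+1.
  have [c1 c2] := gamma_xpath (2 * p + 1) 2.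
  have [d1 d2] := gamma_xpath (2 * p + 2 * n - 1) 2.
  rewrite odd_mod in c1 c2.
  split.
  - rewrite chain_cat c1 c2 /= y1 y2 -odd_mod andbT; apply/eqP.
    by apply: (@modn_eq 0); linlia.
  - by rewrite /= z1 z2 eqxx z3.
  - rewrite pend_cat pend_seq1 y3.
    rewrite (pend_cons G _ (zarr p)) z3 d2.
    by congr (_ %% _); linlia.
  - by rewrite wsum_cat (wsum_cons _ (zarr p.+1)) wsum_nil (wsum_cons _ (zarr p)) !(wsum_xpath _ _ gwt_bnd) !gwt_z; linlia.
have [y1 y2 y3] := gamma_z (p + n.-1).
have [c1 c2] := gamma_xpath (2 * p + 1) (2 * n - 4).
rewrite odd_mod in c1 c2.
split=> //.
- rewrite /= z1 z2 z3 y1 y2 eqxx -odd_mod andbT /=; apply/eqP.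
  by apply: (@modn_eq 0); linlia.
- by rewrite c2 pend_cons pend_seq1 y3; apply: (@modn_eq 1); linlia.
- by rewrite (wsum_cons _ (zarr p)) (wsum_cons _ (zarr (p + n.-1))) wsum_nil (wsum_xpath _ _ gwt_bnd) !gwt_z; linlia.
Qed.

(** An arrow z leaves only odd vertices, so from an even one an x comes first. As z goes back by
    two, the remaining x's start at [s - 2] or [s - 1] modulo 2n. *)
Definition nform (s : nat) (b : bool) (m : nat) : seq nat :=
  if b then
    if odd s then zarr s./2 :: xpath (s + 2 * n - 2) m
    else [:: s.+1, zarr s./2 & xpath (s + 2 * n - 1) m]
  else xpath s m.

Lemma gamma_nform s l : s < 2 * n -> chain G s l ->
  exists b m, peqv G gamma_trips s l (nform s b m).
Proof.
elim: l s => [|x l IH] s hs; first by exists false, 0; exact: Peqv_refl.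
rewrite /= => /and3P[hx /eqP sx cl].
have cons_step l' : peqv G gamma_trips (tgt G x) l l' -> peqv G gamma_trips s (x :: l) (x :: l').
  by move=> h; apply: (@peqv_catl _ _ _ [:: x]).
case: (ltnP x (2 * n)) => hx2.
  have [_ e1 e2] := gamma_bnd hx2; rewrite sx in e1; rewrite e2 in cl cons_step.
  have ex : x = (s + 1) %% (2 * n).
    rewrite e1 modnDml (@modn_eq 1 _ _ x); last linlia.
    by rewrite modn_small.
  have [b [m /cons_step h]] := IH x hx2 cl.
  case: b h => [|] h; last first.
    exists false, m.+1; apply: Peqv_trans h _; rewrite /nform xpathS -ex.
    by rewrite (@xpath_mod x (s + 1)) ?ex ?modn_mod //; exact: Peqv_refl.
  case ox : (odd x) (h); rewrite /nform ox => {}h.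
    (* The rest has the form z x...x and [s] is even: prefixing x gives the normal form x z x...x at
       once. *)
    have es : x = s.+1.
      case: (ltnP s.+1 (2 * n)) => hs2; first by rewrite ex addn1 modn_small.
      by move: ox; rewrite ex; have -> : s + 1 = 2 * n; [lia | rewrite modnn].
    exists true, m; apply: Peqv_trans h _.
    have -> : odd s = false by move: ox; rewrite es /=; case: (odd s).
    rewrite es.
    have -> : s.+1./2 = s./2 by move: ox; rewrite es; lia.
    have -> : s.+1 + 2 * n - 2 = s + 2 * n - 1 by lia.
    exact: Peqv_refl.
  (* Now [s] is odd and the path is x x z x...x; the commutation relation moves z to the front,
     which adds two x's behind it. *)
  have [p ep] : exists p, s = 2 * p + 1.
    exists s./2; have: odd s; last lia.
    case: (ltnP s.+1 (2 * n)) => hs2; last lia.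
    by move: ox; rewrite ex addn1 modn_small //=; case: (odd s).
  exists true, (2 + m); apply: Peqv_trans h _.
  have -> : odd s by lia.
  have -> : s./2 = p by lia.
  rewrite xpathD.
  have -> : s + 2 * n - 2 = 2 * p + 2 * n - 1 by lia.
  have -> : xpath (2 * p + 2 * n - 1 + 2) m = xpath (x + 2 * n - 1) m.
    apply: xpath_mod; rewrite ex -[in RHS]addnBA; last lia.
    by rewrite modnDml; apply: (@modn_eq 0); linlia.
  have cm := commute_trip_in p; rewrite /commute_trip -odd_mod -ep modn_small // in cm.
  have := peqv_catr (xpath (x + 2 * n - 1) m) (peqv_rel G cm).
  rewrite xpathS xpathS /= -ex.
  have -> : zarr p.+1 = zarr x./2.
    rewrite /zarr ex; have -> : (s + 1) %% (2 * n) = 2 * (p.+1 %% n).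
      by rewrite -double_mod; congr (_ %% _); linlia.
    by rewrite (_ : (2 * (p.+1 %% n))./2 = p.+1 %% n) ?modn_mod // mul2n doubleK.
  have -> // : (s + 1 + 1) %% (2 * n) = x.+1.
  rewrite -modnDml -ex modn_small addn1 //; move: ox hx2 => /negbT; clear; lia.
have [p hp ex] : exists2 p, p < n & x = zarr p.
  move: hx; rewrite size_gamma => hx; exists (x - 2 * n); first lia.
  by rewrite /zarr modn_small; lia.
have [_ e1 e2] := gamma_z p; rewrite ex in sx cl cons_step *.
rewrite e1 (modn_small hp) in sx; rewrite e2 in cl cons_step.
have [b [m /cons_step h]] := IH _ (ltn_pmod _ (ltac:(lia) : 0 < 2 * n)) cl.
have os : odd s by rewrite -sx; lia.
have es2 : s./2 = p by rewrite -sx; lia.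
case: b h => [|] h; last first.
  exists true, m; apply: Peqv_trans h _; rewrite /nform os es2.
  rewrite (@xpath_mod _ (s + 2 * n - 2)); first exact: Peqv_refl.
  by rewrite modn_mod -sx; apply: (@modn_eq 0); linlia.
(* Two consecutive arrows z become 2n - 4 arrows x by the second relation. *)
exists false, (2 * n - 4 + m); apply: Peqv_trans h _; rewrite /nform.
have ey : (2 * p + 2 * n - 1) %% (2 * n) = 2 * ((p + n.-1) %% n) + 1.
  by rewrite -odd_mod; apply: (@modn_eq 0); linlia.
rewrite ey.
have -> : odd (2 * ((p + n.-1) %% n) + 1) by lia.
have -> : (2 * ((p + n.-1) %% n) + 1)./2 = (p + n.-1) %% n by lia.
have -> : zarr ((p + n.-1) %% n) = zarr (p + n.-1) by rewrite /zarr modn_mod.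
rewrite xpathD.
have -> : xpath (2 * ((p + n.-1) %% n) + 1 + 2 * n - 2) m = xpath (s + (2 * n - 4)) m.
  apply: xpath_mod; rewrite -ey -addnBA; last lia.
  by rewrite modnDml -sx; apply: (@modn_eq 1); linlia.
have cm := square_trip_in p; rewrite /square_trip (modn_small hp) sx in cm.
exact: (@peqv_catr _ _ _ _ [:: zarr p; zarr (p + n.-1)] _ (peqv_rel G cm)).
Qed.

Lemma nform_stat s b m : s < 2 * n ->
  wsum gwt (nform s b m) = m + b * (n - 2 + ~~ odd s) /\
  pend G (s, nform s b m) = (s + m + b * (2 * n - 2 + ~~ odd s)) %% (2 * n).
Proof.
move=> hs; have xp v k : pend G (v %% (2 * n), xpath v k) = (v + k) %% (2 * n).
  by have [] := gamma_xpath v k.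
case: b; last first.
  have := xp s m; rewrite (modn_small hs) /nform (wsum_xpath _ _ gwt_bnd) => ->.
  by split; [lia | congr (_ %% _); linlia].
have [_ _ z3] := gamma_z s./2.
rewrite /nform; case os : (odd s).
  rewrite pend_cons z3 wsum_cons (wsum_xpath _ _ gwt_bnd) gwt_z.
  have -> : 2 * s./2 + 2 * n - 1 = s + 2 * n - 2 by lia.
  by rewrite xp; split; [lia | congr (_ %% _); linlia].
rewrite !pend_cons z3 !wsum_cons (wsum_xpath _ _ gwt_bnd) gwt_z gwt_bnd; last lia.
have -> : 2 * s./2 + 2 * n - 1 = s + 2 * n - 1 by lia.
by rewrite xp; split; [lia | congr (_ %% _); linlia].
Qed.

Lemma gamma_unique s l l' : s < 2 * n -> chain G s l -> chain G s l' ->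
  pend G (s, l) = pend G (s, l') -> wsum gwt l = wsum gwt l' -> peqv G gamma_trips s l l'.
Proof.
move=> hs cl cl' ep ew.
have [b [m h]] := gamma_nform hs cl; have [b' [m' h']] := gamma_nform hs cl'.
have [_ p1 w1] := peqv_inv homog_gamma h; have [_ p2 w2] := peqv_inv homog_gamma h'.
have [w3 p3] := nform_stat b m hs; have [w4 p4] := nform_stat b' m' hs.
have ne x : (x + n) %% (2 * n) <> x %% (2 * n).
  move/eqP; rewrite -{2}[x]addn0 eqn_modDl mod0n modn_small; lia.
(* At equal weight, a normal form with z and one without it would end at vertices differing by n
   modulo 2n. *)
have hb : b = b'.
  move: p3 p4 w3 w4; rewrite -p1 -p2 -w1 -w2 -ep -ew.
  case: b {h p1 w1}; case: b' {h' p2 w2} => // -> e2 -> e4; exfalso.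
    apply: (ne (s + m + (n - 2 + ~~ odd s))); move: e2.
    have -> : s + m + true * (2 * n - 2 + ~~ odd s) = s + m + (n - 2 + ~~ odd s) + n by lia.
    by move=> ->; congr (_ %% _); linlia.
  apply: (ne (s + m)); move: e2.
  have -> : s + m' + true * (2 * n - 2 + ~~ odd s) = s + m + n by lia.
  by move=> <-; congr (_ %% _); linlia.
subst b'; have em : m = m' by move: w3 w4; rewrite -w1 -w2 -ew; lia.
by subst m'; apply: Peqv_trans h (Peqv_sym h').
Qed.

(** * Boundary paths of the dimer quiver *)

Definition img (l : seq nat) : seq nat :=
  flatten [seq if x < 2 * n then [:: x] else fan_all (x - 2 * n) | x <- l].

Lemma img_cat l l' : img (l ++ l') = img l ++ img l'.
Proof. by rewrite /img map_cat flatten_cat. Qed.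

Lemma img_bnd x : x < 2 * n -> img [:: x] = [:: x].
Proof. by rewrite /img /= => ->. Qed.

Lemma img_z a : img [:: zarr a] = fan_all a.
Proof. by rewrite /img /= /zarr ltnNge leq_addr /= addKn cats0 fan_all_mod. Qed.

Lemma img_xpath s m : img (xpath s m) = xpath s m.
Proof.
rewrite /img /xpath -map_comp; elim: (iota 0 m) => //= j l ->.
by rewrite ltn_pmod //; lia.
Qed.

Lemma fan_all_path a : [/\ chain Q (2 * (a %% n) + 1) (fan_all a),
  pend Q (2 * (a %% n) + 1, fan_all a) = (2 * a + 2 * n - 1) %% (2 * n) & wsum wt (fan_all a) = n - 2].
Proof.
rewrite -cmid_succ -predn_modDl double_mod -cmid_pred /fan_all.
have [-> ->] := @fan_path a a.+1 (a + n.-1) (ltac:(lia)) (ltac:(lia)) (ltac:(lia)) (chord_succ a) (chord_last a).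
by split=> //; rewrite wsum_fan ?chord_succ ?chord_last //; lia.
Qed.

Lemma gamma_arrow x : x < size (qarr G) -> x < 2 * n \/ exists2 p, p < n & x = zarr p.
Proof.
rewrite size_gamma => hx; case: (ltnP x (2 * n)) => h; [by left | right].
by exists (x - 2 * n); [lia | rewrite /zarr modn_small; lia].
Qed.

(** A full fan has the ends and the weight of z, so [phi] preserves classes of paths, and with them
    class sums. *)
Lemma img_inv s l : s < 2 * n -> chain G s l ->
  [/\ chain Q s (img l), pend Q (s, img l) = pend G (s, l) & wsum wt (img l) = wsum gwt l].
Proof.
elim: l s => [//|x l IH] s hs /=; case/and3P => hx /eqP sx cl.
rewrite -cat1s img_cat.
have [h|[p hp ex]] := gamma_arrow hx.
  have [g1 g2 g3] := gamma_bnd h; have [q1 q2 q3] := bnd_arrow h.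
  rewrite g3 in cl; have [i1 i2 i3] := IH x h cl.
  rewrite (img_bnd h) /= !pend_cons !wsum_cons q1 q2 -g2 sx eqxx q3 g3 i1 i2 i3.
  by rewrite /gwt /wt h.
have [g1 g2 g3] := gamma_z p; have [f1 f2 f3] := fan_all_path p.
rewrite ex g3 in cl; have [i1 i2 i3] := IH _ (ltn_pmod _ (ltac:(lia) : 0 < 2 * n)) cl.
rewrite ex g2 in sx.
rewrite ex img_z chain_cat pend_cat wsum_cat -sx f1 f2 f3 i1 i2 i3 /= pend_cons g3.
by rewrite wsum_cons gwt_z.
Qed.

(* Both sides are [x] times a small cycle: the edge from [a] to [a+1] lies in a single triangle, whose
   black face replaces the white face at [a] on one side and the white face at [a+1] on the other. *)
Lemma fan_commute a : peqv Q R (cmid a a.+1)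
  (xpath (2 * a + 1) 2 ++ fan_all a.+1) (fan_all a ++ xpath (2 * a + 2 * n - 1) 2).
Proof.
have ch : chord a.+1 (a + n).
  by rewrite chordC (@chord_mod _ _ a a.+1) ?chord_succ ?modnDr.
have [k t1] := chord_apex (ltac:(lia) : a.+2 < a + n) (ltac:(lia) : a + n < a.+1 + n) ch.
have [l1 l2 l3] := tri_lt t1; have [s1 s2 s3] := tri_chord t1.
have t0 : tri a a.+1 k.
  rewrite -(tri_shift 1) mul1n !(addnC n); exact: tri_rot (tri_rot t1).
have [c1 _ c3] := tri_chord t0.
have := dimer_trip t0; have := dimer_trip t1.
rewrite /corner_rest (_ : a.+1 + n.-1 = a + n); last lia.
rewrite !fan_nil cats0 -!xpath2 cat0s => r1 r0.
have x2 : xpath (2 * a.+1 + 2 * n - 1) 2 = xpath (2 * a + 1) 2.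
  by apply: xpath_mod; apply: (@modn_eq 1); lia.
rewrite x2 in r1.
have eA : fan_all a = arr a a.+1 k :: fan a k (a + n.-1) by rewrite /fan_all (fan_cons t0) //; lia.
have eB : fan_all a.+1 = fan a.+1 a.+2 k ++ [:: arr a.+1 k (a + n)].
  rewrite /fan_all (_ : a.+1 + n.-1 = a + n); last lia.
  by rewrite (fan_rcons _ _ (chord_succ a.+1) t1) ?cats1 //; lia.
rewrite eA eB.
(* The middle path is the black face of the triangle on [a], [a.+1], [k], read from the midpoint of
   the side they share with the boundary. *)
apply: (@Peqv_trans _ _ _ _ [:: arr a a.+1 k; arr k a a.+1; arr a.+1 k a]); last first.
  apply: Peqv_sym; apply: (@peqv_catl _ _ _ [:: _]); rewrite pend_seq1.
  by have [_ _ ->] := arr_arrow t0; exact: peqv_rel.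
rewrite catA.
have -> : [:: arr a a.+1 k; arr k a a.+1; arr a.+1 k a] =
    [:: arr (a + n) a.+1 k; arr k (a + n) a.+1] ++ [:: arr a.+1 k (a + n)].
  by congr [:: _; _; _]; apply: arr_mod; rewrite ?modnDr.
apply: peqv_catr.
have -> : cmid a a.+1 = cmid a.+1 (a + n) by rewrite cmidC; apply: cmid_mod; rewrite ?modnDr.
exact: peqv_rel.
Qed.

Lemma fan_square a : peqv Q R (cmid a a.+1)
  (fan_all a ++ fan_all (a + n.-1)) (xpath (2 * a + 1) (2 * n - 4)).
Proof.
have := fan_fan (ltac:(lia) : a < a + n.-1) (ltac:(lia)) (chord_last a).
rewrite (_ : 2 * (a + n.-1 - a.+1) = 2 * n - 4); last lia.
by rewrite /fan_all (_ : (a + n.-1).+1 = a + n); last lia.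
Qed.

Lemma img_peqv s l l' : s < 2 * n -> chain G s l ->
  peqv G gamma_trips s l l' -> peqv Q R s (img l) (img l').
Proof.
move=> hs cl h; elim: h cl => {l l'} [l|l l' h IH|l1 l2 l3 h1 IH1 h2 IH2|p u v q h] cl.
- exact: Peqv_refl.
- by apply/Peqv_sym/IH; have [-> _ _] := peqv_inv homog_gamma h.
- apply: Peqv_trans (IH1 cl) (IH2 _).
  by have [<- _ _] := peqv_inv homog_gamma h1.
rewrite chain_cat in cl; case/andP: cl => cp _.
have [_ ep _] := img_inv hs cp.
rewrite !img_cat; apply: peqv_ctx; rewrite ep.
have {h} [a _ [] e] := (mem_gamma_trips _).1 h;
  move: (congr1 (fun t => t.1.1) e) (congr1 (fun t => t.1.2) e) (congr1 snd e);
  rewrite /commute_trip /square_trip ![(_, _).1]/fst ![(_, _).2]/snd => -> -> ->;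
  rewrite -cmid_succ.
  rewrite -[_ :: xpath _ _]cat1s !img_cat !img_xpath !img_z; exact: fan_commute.
rewrite -cat1s img_cat !img_xpath !img_z; exact: fan_square.
Qed.

(** * Factoring paths that start at the boundary *)

Lemma odd_boundary a : 2 * (a %% n) + 1 < 2 * n.
Proof. by have := ltn_pmod a (ltnW (ltnW n3)); move: (a %% n) => r hr; lia. Qed.

(** The shape of a path halted at the midpoint of the chord [ab]: a path [g] of Gamma(n), then an
    unfinished turn around [a]. *)
Definition fan_factored (s : nat) (l : seq nat) : Prop :=
  exists g a b, [/\ chain G s g, a < b < a + n, chord a b, pend G (s, g) = 2 * (a %% n) + 1
    & peqv Q R s l (img g ++ fan a a.+1 b)].

Definition factored (s : nat) (l : seq nat) : Prop :=
  exists g, [/\ chain G s g, pend Q (s, l) < 2 * n & peqv Q R s l (img g)].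

Lemma fan_factored_end s l g a b : s < 2 * n -> chain G s g -> a < b < a + n -> chord a b ->
  pend G (s, g) = 2 * (a %% n) + 1 -> peqv Q R s l (img g ++ fan a a.+1 b) ->
  pend Q (s, l) = cmid a b.
Proof.
move=> hs cg /andP[ab ba] sab eg h; have [_ -> _] := peqv_inv homog_dimer h.
have [_ eq _] := img_inv hs cg.
rewrite pend_cat eq eg -cmid_succ.
by have [_ ->] := @fan_path a a.+1 b (ltac:(lia)) ab ba (chord_succ a) sab.
Qed.

(** A partial fan ending at the boundary is empty or full; in the second case it is the image of z
    and is absorbed into [g]. *)
Lemma fan_factored_boundary s l : s < 2 * n -> pend Q (s, l) < 2 * n ->
  fan_factored s l -> factored s l.
Proof.
move=> hs hl [g [a [b [cg ab sab eg h]]]].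
have e := fan_factored_end hs cg ab sab eg h.
have /andP[l1 l2] := ab.
have [eb|eb] := cmid_boundary l1 l2 (ltac:(by rewrite -e) : cmid a b < 2 * n).
  by exists g; split=> //; move: h; rewrite eb fan_nil cats0.
have [z1 z2 z3] := gamma_z a.
exists (g ++ [:: zarr a]); split=> //.
  by rewrite chain_cat cg eg /= z1 z2 eqxx.
by move: h; rewrite eb img_cat img_z.
Qed.

(** A triangle arrow leaving the boundary at the corner [c] starts at the side after [c], since no
    triangle follows the side before it; thus it opens a new fan. *)
Lemma factored_rcons s l x : s < 2 * n -> chain Q s l -> x < size (qarr Q) ->
  src Q x = pend Q (s, l) -> factored s l -> factored s (rcons l x) \/ fan_factored s (rcons l x).
Proof.
move=> hs cl hx sx [g [cg el h]]; rewrite -cats1.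
have [_ ep _] := peqv_inv homog_dimer h; have [_ eg _] := img_inv hs cg.
have hc := peqv_catr [:: x] h.
case: (ltnP x (2 * n)) => hx2.
  left; exists (g ++ [:: x]); have [g1 g2 g3] := gamma_bnd hx2; have [q1 q2 q3] := bnd_arrow hx2.
  split; last by rewrite img_cat img_bnd.
  - by rewrite chain_cat cg /= g1 g2 -q2 sx ep eg eqxx.
  - by rewrite pend_cat pend_seq1 q3.
have [c [d [e [hc2 t ex]]]] := arr_other (ltac:(by rewrite hx2) : 2 * n <= x < size (qarr Q)).
have [_ s1 _] := arr_arrow t; have [l1 l2 l3] := tri_lt t; have [c1 _ c3] := tri_chord t.
right.
have [ed|ed] : d = c.+1 \/ d = c + n.-1.
  by apply: cmid_boundary => //; [lia | rewrite -s1 -ex sx].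
  exists g, c, e; split=> //; first by apply/andP; split=> //; lia.
    by rewrite -eg -ep -sx ex s1 ed cmid_succ.
  by rewrite ed in t ex; rewrite (fan_one t) -ex.
by move: l2 l3; rewrite ed; lia.
Qed.

Lemma tri_relift a c d e : c = a %[mod n] -> tri c d e ->
  exists d' e', [/\ tri a d' e', d' = d %[mod n] & e' = e %[mod n]].
Proof.
move=> eca t; have [l1 l2 l3] := tri_lt t.
have ec := divn_eq c n; have ea := divn_eq a n.
move: (c %/ n) (a %/ n) (c %% n) ec ea eca => q2 q1 r ec ea er; rewrite -er in ea.
have [d' ed] := @lift_from q2 d (ltac:(linlia)).
have [e' ee] := @lift_from q2 e (ltac:(linlia)).
exists (q1 * n + d'), (q1 * n + e'); rewrite ea ed ee !modnMDl; split=> //.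
by rewrite tri_shift; move: t; rewrite ec ed ee tri_shift.
Qed.

Lemma fan_factored_rcons s l x : s < 2 * n -> x < size (qarr Q) -> 2 * n <= x ->
  src Q x = pend Q (s, l) -> fan_factored s l -> fan_factored s (rcons l x).
Proof.
move=> hs hx hx2 sx [g [a [b [cg ab sab eg h]]]].
have el := fan_factored_end hs cg ab sab eg h.
have /andP[l1 l2] := ab; rewrite -cats1.
have hc := peqv_catr [:: x] h; rewrite -catA in hc.
have [c [d [e [_ t ex]]]] := arr_other (ltac:(by rewrite hx2) : 2 * n <= x < size (qarr Q)).
have [k1 k2 k3] := tri_lt t; have [c1 c2 c3] := tri_chord t.
have [_ s1 _] := arr_arrow t.
have em : cmid c d = cmid a b by rewrite -s1 -ex sx.
have [_ eqg _] := img_inv hs cg.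
have [[eca edb]|[ecb eda]] := cmid_inj k1 (ltn_trans k2 k3) l1 l2 c1 sab em.
  (* The arrow lies at the corner [a] and prolongs the fan there. *)
  have [d' [e' [t' ed ee]]] := tri_relift eca t; have [m1 m2 m3] := tri_lt t'.
  have eb : d' = b by apply: (@mod_small_inj a) => //; [linlia | rewrite ed].
  rewrite eb in t' ed m2.
  have ex' : x = arr a b e' by rewrite ex; apply: arr_mod.
  exists g, a, e'; split=> //; first by rewrite (ltn_trans l1 m2).
    by have [] := tri_chord t'.
  by rewrite (fan_rcons _ _ (chord_succ a) t') // -cats1 -ex'.
(* The arrow lies at the corner [b], in the triangle [akb] with [k] between [a] and [b]. *)
have [d' [e' [t' ed ee]]] := tri_relift ecb t; have [m1 m2 m3] := tri_lt t'.
have eb : d' = a + n.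
  by apply: (@mod_small_inj b) => //; [linlia | linlia | rewrite ed modnDr].
rewrite eb in t' ed m1 m2.
have ek : e' = (e' - n) + n by linlia.
have ex' : x = arr b (a + n) (e' - n + n) by rewrite ex; apply: arr_mod; rewrite -?ek.
have {}t' : tri a (e' - n) b.
  by rewrite -(tri_shift 1) mul1n !(addnC n) -ek; exact: tri_rot t'.
move: (e' - n) ex' t' => k ex' t'; have [j1 j2 j3] := tri_lt t'; have [s1' s2' s3'] := tri_chord t'.
have [x1 x2] := gamma_xpath (2 * a + 1) (2 * (k - a)); rewrite odd_mod in x1 x2.
(* By [fan_turn] the turn moves to the corner [k]. The two fans along [ak] become 2(k - a - 1)
   boundary arrows by [fan_fan], and two more arrows pass the corner [k]. *)
exists (g ++ xpath (2 * a + 1) (2 * (k - a))), k, b; split=> //.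
- by rewrite chain_cat cg eg x1.
- by apply/andP; split=> //; linlia.
- rewrite pend_cat eg x2 -odd_mod; apply: (@modn_eq 0); linlia.
apply: Peqv_trans hc _; rewrite img_cat img_xpath -catA ex'; apply: peqv_catl.
rewrite eqg eg -cmid_succ (xpath_turn j1) -catA.
apply: Peqv_trans (fan_turn t') _; rewrite -catA catA; apply: peqv_catr.
by apply: fan_fan => //; linlia.
Qed.

Lemma path_factored s l : s < 2 * n -> chain Q s l -> factored s l \/ fan_factored s l.
Proof.
move=> hs; elim/last_ind: l => [_|l x IH].
  by left; exists [::]; split=> //; exact: Peqv_refl.
rewrite -cats1 chain_cat cats1 /= => /andP[cl /and3P[hx /eqP sx _]].
case: (IH cl) => [|ff]; first exact: factored_rcons.
case: (ltnP x (2 * n)) => hx2; last by right; exact: fan_factored_rcons.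
apply: factored_rcons => //; apply: fan_factored_boundary => //.
have [_ q2 _] := bnd_arrow hx2.
by rewrite -sx q2 ltn_pmod //; linlia.
Qed.

Lemma boundary_path s l : s < 2 * n -> chain Q s l -> pend Q (s, l) < 2 * n -> factored s l.
Proof. by move=> hs cl hl; case: (path_factored hs cl) => // /(fan_factored_boundary hs hl). Qed.

(** * The isomorphism *)

(** No black face meets a boundary arrow, and the only white face through it is that of the corner
    [x./2]. This identifies the boundary vertices and so [eb]. *)
Lemma nfaces_bnd x : x < 2 * n -> nfaces D x = 1.
Proof.
move=> hx; rewrite /nfaces /D /DT /= count_cat.
rewrite [X in _ + X](_ : _ = 0) ?addn0; last first.
  apply/eqP; rewrite -leqn0 leqNgt -has_count; apply/hasPn => F hF.
  by apply/negP => /(neg_face_ge hF)/andP[]; rewrite leqNgt hx.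
rewrite count_map (eq_in_count (a2 := pred1 x./2)); last first.
  move=> p; rewrite mem_iota => /andP[_ hp].
  transitivity (x \in 2 * p + 1 :: rcons (fan_all p) (2 * p)); first by rewrite -pos_faceE.
  rewrite inE mem_rcons inE /=.
  have -> : (x \in fan_all p) = false.
    apply/negP => /mem_fan_all[b [c [t ex]]]; have [/andP[lo _] _ _] := arr_arrow t.
    by move: hx; rewrite ex ltnNge lo.
  lia.
by rewrite count_uniq_mem ?iota_uniq // mem_iota; case: ltnP; lia.
Qed.

Lemma nfaces_inner x : 2 * n <= x < size (qarr Q) -> 1 < nfaces D x.
Proof.
move=> /arr_other[p [b [c [hp t ex]]]].
rewrite /nfaces count_cat; apply: (@leq_add 1 1); rewrite -has_count; apply/hasP.
  exists (2 * p + 1 :: rcons (fan_all p) (2 * p)); first by apply/pos_facesP; exists p.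
  by rewrite inE mem_rcons inE; apply/or3P/Or33/mem_fan_all; exists b, c.
by have [F hF [aF _]] := neg_rest t; exists F => //; rewrite ex.
Qed.

Lemma is_bvertexE v : is_bvertex D v = (v < 2 * n).
Proof.
apply/hasP/idP => [[x]|hv].
  rewrite mem_iota => /andP[_ hx] /andP[/eqP nx hv].
  have hx2 : x < 2 * n.
    by rewrite ltnNge; apply/negP => lo; have := @nfaces_inner x; rewrite lo nx => /(_ hx).
  have [_ e1 e2] := bnd_arrow hx2; case/orP: hv => /eqP <-; last by rewrite e2.
  by rewrite e1 ltn_pmod //; linlia.
have [h _ e] := bnd_arrow hv.
by exists v; rewrite ?mem_iota //= nfaces_bnd //= e eqxx orbT.
Qed.

Lemma gamma_end s l : s < 2 * n -> chain G s l -> pend G (s, l) < 2 * n.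
Proof.
move=> hs; case/lastP: l => // l x; rewrite -cats1 chain_cat pend_cat pend_seq1 /=.
move=> /andP[_ /and3P[hx _ _]]; have [h|[p _ ->]] := gamma_arrow hx.
  by have [_ _ ->] := gamma_bnd h.
by have [_ _ ->] := gamma_z p; rewrite ltn_pmod //; linlia.
Qed.

Lemma predn_double p : p < n ->
  (2 * p + 2 * n - 1) %% (2 * n) = if p == 0 then 2 * n - 1 else 2 * p - 1.
Proof.
move=> hp; case: eqP => [->|p0]; first by rewrite modn_small; lia.
rewrite (@modn_eq 1 _ _ (2 * p - 1)); last lia.
by rewrite modn_small; lia.
Qed.

(** * The element t as a sum of cycles *)

Definition cycle_odd (p : nat) : qpath :=
  ((2 * p + 2 * n - 1) %% (2 * n), [:: 2 * p; 2 * p + 1; zarr p]).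

Definition cycle_even (p : nat) : qpath := (2 * p, [:: 2 * p + 1; zarr p; 2 * p]).

(** One cycle of weight n at each of the 2n vertices ([t_cyclesP], [t_cycles_starts]); the
    centrality of t rests on this alone, together with [gamma_ideal]. *)
Definition t_cycles : seq qpath :=
  [seq cycle_odd p | p <- iota 0 n] ++ [seq cycle_even p | p <- iota 0 n].

Lemma t_cyclesP c : c \in t_cycles ->
  [/\ chain G c.1 c.2, pend G c = c.1 & wsum gwt c.2 = n].
Proof.
have main p : p < n -> let s := (2 * p + 2 * n - 1) %% (2 * n) in
    [/\ chain G s [:: 2 * p; 2 * p + 1; zarr p], tgt G (zarr p) = s,
      chain G (2 * p) [:: 2 * p + 1; zarr p; 2 * p], tgt G (2 * p) = 2 * p
    & wsum gwt [:: 2 * p; 2 * p + 1; zarr p] = n].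
  move=> hp /=; have [z1 z2 z3] := gamma_z p; rewrite (modn_small hp) in z2.
  have [a1 a2 a3] := gamma_bnd (ltac:(lia) : 2 * p < 2 * n).
  have [b1 b2 b3] := gamma_bnd (ltac:(lia) : 2 * p + 1 < 2 * n).
  have e : (2 * p + 1 + 2 * n - 1) %% (2 * n) = 2 * p.
    rewrite (@modn_eq 1 _ _ (2 * p)); last linlia.
    by rewrite modn_small //; linlia.
  rewrite /= a1 a2 a3 b1 b2 b3 z1 z2 z3 e !eqxx; split=> //.
  by rewrite !wsum_cons wsum_nil gwt_z !gwt_bnd; linlia.
rewrite mem_cat => /orP[] /mapP[p]; rewrite mem_iota => /andP[_ /main[m1 m2 m3 m4 m5]] ->.
  by split.
split=> //=; rewrite -[RHS]m5 !wsum_cons; lia.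
Qed.

Lemma t_cycles_starts : perm_eq [seq c.1 | c <- t_cycles] (iota 0 (2 * n)).
Proof.
have u : uniq [seq c.1 | c <- t_cycles].
  rewrite map_cat -!map_comp cat_uniq; apply/and3P; split.
  - rewrite map_inj_in_uniq ?iota_uniq // => p q; rewrite !mem_iota /= => hp hq.
    by rewrite !predn_double //; case: eqP; case: eqP; lia.
  - apply/hasPn => x /mapP[p _ ->]; apply/mapP => -[q]; rewrite mem_iota /= => hq.
    by rewrite predn_double //; case: eqP; lia.
  - by rewrite map_inj_in_uniq ?iota_uniq // => p q _ _ /=; lia.
apply: uniq_perm => //; first exact: iota_uniq.
have [] // := uniq_min_size u (s2 := iota 0 (2 * n)).
- move=> x; rewrite map_cat -!map_comp mem_cat mem_iota add0n.
  case/orP => /mapP[p]; rewrite mem_iota /= => hp ->; last lia.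
  by rewrite ltn_pmod //; lia.
- by rewrite size_map size_cat !size_map !size_iota; lia.
Qed.

(** * The map [phi], its kernel and image, and the centrality of t *)

Section Algebra.
Variable K : numClosedFieldType.
Local Open Scope ring_scope.

Let J := dimer_rels K D.
Let I := Gamma_rels K n.
Let e := eb K D.

Lemma Gamma_relsE : I = [seq Defs.rel K r.1.1 r.1.2 r.2 | r <- gamma_trips].
Proof. by rewrite /I /Gamma_rels /gamma_trips map_flatten -map_comp. Qed.

Lemma ebE : e = [seq (1, (v, [::])) | v <- iota 0 (2 * n)].
Proof.
rewrite /e /eb iotaD filter_cat (eq_in_filter (a2 := predT)); last first.
  by move=> v; rewrite mem_iota is_bvertexE.
rewrite filter_predT (eq_in_filter (a2 := pred0)) ?filter_pred0 ?cats0 //.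
by move=> v; rewrite mem_iota is_bvertexE /=; lia.
Qed.

Let E (i : nat) : lc K := [:: (1, (i, [::]))].
Let A (x : nat) : lc K := [:: (1, (src G x, img [:: x]))].

Lemma phi_pathE s l : (s < 2 * n)%N -> chain G s l ->
  phi_path Q E A (s, l) = [:: (1, (s, img l))].
Proof.
move=> hs cl; rewrite /phi_path /= -[img l]cat0s.
(* The claim is generalised to an arbitrary prefix [p], the accumulator of [foldl]. *)
have gen p v : (v < 2 * n)%N -> chain G v l -> pend Q (s, p) = v ->
    foldl (lc_mul Q) [:: (1, (s, p))] (map A l) = [:: (1, (s, p ++ img l))]; last exact: (gen [::] s hs cl erefl).
elim: l p v {cl} => [|x l IH] p v hv cl ep; first by rewrite cats0.
have [c1 c2] : chain G v [:: x] /\ chain G (tgt G x) l.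
  by case/and3P: cl => h1 h2 h3; rewrite /= h1 h2.
have sx : src G x = v by case/and3P: c1 => _ /eqP.
have hv' := gamma_end hv c1; have [_ ei _] := img_inv hv c1.
rewrite [map _ _]/= [foldl _ _ _]/= {1}/A lc_mul_mono ep sx eqxx mulr1.
rewrite (IH _ _ hv') //; last by rewrite pend_cat ep ei.
by rewrite -[x :: l]cat1s img_cat catA.
Qed.

Lemma phiE f : phi G Q E A f = [seq (c.1, (c.2.1, img c.2.2)) | c <- f & pvalid G c.2].
Proof.
rewrite /phi -[RHS]flatten_map1; congr flatten; apply/eq_in_map => -[k [s l]].
rewrite mem_filter => /andP[/andP[/= hs cl] _].
by rewrite phi_pathE //= /lc_scale /= mulr1.
Qed.

Lemma phi_csum f k : csum Q (fun p => cls Q wt p == k) (phi G Q E A f) =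
  csum G (fun p => cls G gwt p == k) f.
Proof.
rewrite phiE /csum big_map big_filter_cond; apply: eq_bigl => -[x [s l]] /=.
rewrite /pvalid /=; case hs: (s < 2 * n)%N => //=; case cl: (chain G s l) => //=.
have [-> e2 e3] := img_inv hs cl.
by rewrite /cls /= e2 e3 (leq_trans hs) ?leq_addr.
Qed.

(** In Gamma(n) paths of equal class are congruent, so [csum_in_ideal] applies to every
    combination. *)
Lemma gamma_ideal f : (forall k, csum G (fun p => cls G gwt p == k) f = 0) -> in_ideal G I f.
Proof.
rewrite Gamma_relsE; apply: csum_in_ideal homog_gamma _ _ => -[s l] [s' l'] _ _.
move=> /andP[/= hs cl] /andP[_ /= cl'] [es ep ew]; subst s'.
exact: gamma_unique.
Qed.

(** Class sums vanish on the dimer ideal and are preserved by [phi], so [gamma_ideal] gives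
    injectivity. Conversely, image paths of equal class come from congruent paths of Gamma(n), and
    [img_peqv] transports the congruence. *)
Lemma phi_ideal f : in_ideal Q J (phi G Q E A f) <-> in_ideal G I f.
Proof.
split=> h.
  apply: gamma_ideal => k; rewrite -phi_csum.
  by apply: (in_ideal_csum homog_dimer); rewrite -dimer_relsE.
rewrite /J dimer_relsE; apply: (csum_in_ideal homog_dimer); last first.
  move=> k; rewrite phi_csum; apply: (in_ideal_csum homog_gamma).
  by rewrite -Gamma_relsE.
rewrite phiE -map_comp => p q /mapP[[x [s l]]]; rewrite mem_filter => /andP[/andP[/= hs cl] _] ->.
case/mapP=> -[y [s' l']]; rewrite mem_filter => /andP[/andP[/= _ cl'] _] -> _ _.
rewrite /cls /= => -[es ep ew]; subst s'.
have [_ e1 e2] := img_inv hs cl; have [_ e3 e4] := img_inv hs cl'.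
apply: img_peqv => //; apply: gamma_unique => //; first by rewrite -e1 -e3.
by rewrite -e2 -e4.
Qed.

Lemma sum_iota_eq (v m : nat) (b : bool) (x : K) :
  \sum_(u <- iota 0 m | (u == v) && b) x = if (v < m)%N && b then x else 0.
Proof.
case: b; last by rewrite andbF big1 // => u; rewrite andbF.
rewrite (eq_bigl (pred1 v)) => [|u]; last by rewrite andbT.
rewrite andbT; case: ltnP => hv; last first.
  by rewrite big1_seq // => u /andP[/eqP ->]; rewrite mem_iota ltnNge hv.
rewrite big_mkcond (bigD1_seq v) ?mem_iota ?iota_uniq //= eqxx big1 ?addr0 // => u.
by move=> /negbTE ->.
Qed.

Lemma csum_eb_eb P g : csum Q P (lc_mul Q (lc_mul Q e g) e) =
  csum Q (fun p => P p && ((p.1 < 2 * n)%N && (pend Q p < 2 * n)%N)) g.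
Proof.
have right (P' : pred qpath) h : csum Q P' (lc_mul Q h e) =
    csum Q (fun p => P' p && (pend Q p < 2 * n)%N) h.
  rewrite csum_mul /csum [RHS]big_mkcond; apply: eq_bigr => c _.
  rewrite ebE big_map /= cats0 -surjective_pairing.
  rewrite (eq_bigl (fun u => (u == pend Q c.2) && (pvalid Q c.2 && P' c.2))).
    by rewrite sum_iota_eq mulr1; congr (if _ then _ else _); rewrite andbC andbA.
  by move=> u; rewrite eq_sym.
have left (P' : pred qpath) h : csum Q P' (lc_mul Q e h) =
    csum Q (fun p => P' p && (p.1 < 2 * n)%N) h.
  rewrite csum_mul ebE big_map /csum.
  rewrite (exchange_big_dep xpredT) //= [RHS]big_mkcond; apply: eq_bigr => c _.
  rewrite (eq_bigl (fun u => (u == c.2.1) && (pvalid Q c.2 && P' c.2))).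
    by rewrite sum_iota_eq mul1r; congr (if _ then _ else _); rewrite andbC andbA.
  by move=> u; rewrite /pend /=; case: eqP => // ->; rewrite -surjective_pairing.
rewrite right left; apply: eq_bigl => c; congr (_ && _).
by rewrite -andbA; congr (_ && _); rewrite andbC.
Qed.

(** Multiplying by [e] on both sides keeps the paths from boundary to boundary; each valid one is
    congruent to some [img h] by [boundary_path], and invalid ones are 0. *)
Lemma phi_surj g : exists f, cong Q J (phi G Q E A f) (lc_mul Q (lc_mul Q e g) e).
Proof.
pose b (c : K * qpath) := (c.2.1 < 2 * n)%N && (pend Q c.2 < 2 * n)%N.
suff [f hf] : exists f, cong Q J (phi G Q E A f) [seq c <- g | b c].
  exists f; apply: cong_trans hf _; apply: cong_eq; apply: lc_eq_csum => p.
  rewrite csum_eb_eb /csum big_filter_cond; apply: eq_bigl => c.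
  by rewrite andbC -!andbA.
elim: g => [|c g [f hf]]; first by exists [::]; apply: cong_eq.
rewrite /=; case: ifP => [hb|_]; last by exists f.
case vc: (pvalid Q c.2); last first.
  exists f; rewrite -[phi _ _ _ _ _]cat0s -cat1s; apply: cong_cat hf.
  by apply: cong_eq; apply: lc_eq_csum => p; rewrite csum_cons vc add0r.
case/andP: vc => _ cl; case/andP: hb => hs he.
rewrite [c.2]surjective_pairing in he.
have [h [ch _ eh]] := boundary_path hs cl he.
exists ((c.1, (c.2.1, h)) :: f).
have -> : phi G Q E A ((c.1, (c.2.1, h)) :: f) = [:: (c.1, (c.2.1, img h))] ++ phi G Q E A f.
  by rewrite !phiE /= {1}/pvalid /= hs ch.
rewrite -[c :: _]cat1s; apply: cong_cat hf; rewrite /J dimer_relsE.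
have := peqv_cong homog_dimer c.1 (Peqv_sym eh).
by rewrite -!surjective_pairing.
Qed.

Lemma t_elemE : t_elem K n = [seq (1, c) | c <- t_cycles].
Proof.
have hx i p : (p < n)%N -> (i = 2 * p + 1 \/ i = 2 * p + 2)%N -> xa n i = (i - 1)%N.
  move=> hp hi; rewrite /xa (@modn_eq 1 _ _ (i - 1)); last lia.
  by rewrite modn_small; lia.
have hz p : (p < n)%N -> za n (1 + p) = zarr p.
  move=> hp; rewrite /za /zarr (@modn_eq 1 _ _ p) //; lia.
rewrite /t_elem /t_cycles map_cat -!map_comp -[1%N]addn0 iotaDl -!map_comp.
congr (_ ++ _); apply/eq_in_map => p; rewrite mem_iota => /andP[_ hp] /=;
  rewrite hz // !(hx _ p) //; try lia; rewrite /apath /=.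
- have -> : (2 * (1 + p) - 1 - 1 = 2 * p)%N by lia.
  have -> : (2 * (1 + p) - 1 = 2 * p + 1)%N by lia.
  by have [_ -> _] := gamma_bnd (ltac:(lia) : (2 * p < 2 * n)%N).
- have -> : (2 * (1 + p) - 1 - 1 = 2 * p)%N by lia.
  have -> : (2 * (1 + p) - 1 = 2 * p + 1)%N by lia.
  have [_ -> _] := gamma_bnd (ltac:(lia) : (2 * p + 1 < 2 * n)%N).
  rewrite (@modn_eq 1 _ _ (2 * p)); last lia.
  by rewrite modn_small //; lia.
Qed.

Lemma sum_t_cycles (v : nat) (b : bool) (x : K) :
  \sum_(c <- t_cycles | (c.1 == v) && b) x = if (v < 2 * n)%N && b then x else 0.
Proof.
rewrite -sum_iota_eq -(perm_big _ t_cycles_starts) big_map.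
by apply: eq_bigl.
Qed.

(** For each valid path of [f] exactly one cycle of t fits before it and one after it. Both products
    keep the ends of the path and raise its weight by n, so the two sides have equal class sums. *)
Lemma t_central f : cong G I (lc_mul G (t_elem K n) f) (lc_mul G f (t_elem K n)).
Proof.
apply: gamma_ideal => k; rewrite csum_cat csum_scale mulN1r.
pose B (d : K * qpath) := pvalid G d.2 && ((d.2.1, pend G d.2, (n + wsum gwt d.2.2)%N) == k).
have vsp (d : K * qpath) : B d -> (d.2.1 < 2 * n)%N && (pend G d.2 < 2 * n)%N.
  by case/andP=> /andP[hs cl] _; rewrite hs [d.2]surjective_pairing gamma_end.
suff [-> ->] : csum G (fun p => cls G gwt p == k) (lc_mul G (t_elem K n) f) = \sum_(d <- f | B d) d.1
    /\ csum G (fun p => cls G gwt p == k) (lc_mul G f (t_elem K n)) = \sum_(d <- f | B d) d.1.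
  by rewrite addrN.
rewrite !csum_mul t_elemE big_map; split.
  rewrite (exchange_big_dep xpredT) //= [RHS]big_mkcond; apply: eq_bigr => d _.
  rewrite big_seq_cond (eq_bigl (fun c => (c \in t_cycles) && ((c.1 == d.2.1) && B d))).
    rewrite -big_seq_cond mul1r sum_t_cycles.
    by case hB: (B d); rewrite ?andbF // andbT; have /andP[-> _] := vsp d hB.
  move=> c; rewrite /=; case hc: (c \in t_cycles) => //=.
  have [c1 c2 c3] := t_cyclesP hc; rewrite c2; case: eqP => //= es.
  rewrite /B /pvalid /cls /= chain_cat pend_cat wsum_cat -surjective_pairing c1 c2 c3 es.
  by rewrite -surjective_pairing.
rewrite [RHS]big_mkcond; apply: eq_bigr => d _; rewrite big_map.
rewrite big_seq_cond (eq_bigl (fun c => (c \in t_cycles) && ((c.1 == pend G d.2) && B d))).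
  rewrite -big_seq_cond /= mulr1 sum_t_cycles.
  by case hB: (B d); rewrite ?andbF // andbT; have /andP[_ ->] := vsp d hB.
move=> c; rewrite /=; case hc: (c \in t_cycles) => //=.
have [c1 c2 c3] := t_cyclesP hc; rewrite eq_sym; case: eqP => //= es.
rewrite /B /pvalid /cls /= chain_cat pend_cat wsum_cat -!surjective_pairing -es c1 c3.
by rewrite -surjective_pairing c2 andbT addnC.
Qed.

Lemma E_idem i : cong Q J (lc_mul Q (E i) (E i)) (E i).
Proof. by rewrite lc_mul_mono /= eqxx mulr1; apply: cong_eq. Qed.

Lemma E_orth i j : i != j -> in_ideal Q J (lc_mul Q (E i) (E j)).
Proof.
move=> h; rewrite lc_mul_mono /= (negbTE h).
by apply: in_ideal0 => p; rewrite csum_nil.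
Qed.

Lemma E_sum : cong Q J (flatten [seq E i | i <- iota 0 (2 * n)]) e.
Proof. by rewrite flatten_map1 ebE; apply: cong_eq. Qed.

Lemma A_ends x : (x < size (qarr G))%N ->
  cong Q J (A x) (lc_mul Q (lc_mul Q (E (src G x)) (A x)) (E (tgt G x))).
Proof.
move=> hx; have hs : (src G x < 2 * n)%N.
  have [h|[p _ ->]] := gamma_arrow hx.
    by have [_ -> _] := gamma_bnd h; rewrite ltn_pmod //; linlia.
  by have [_ -> _] := gamma_z p; exact: odd_boundary.
have c1 : chain G (src G x) [:: x] by rewrite /= hx eqxx.
have [_ ei _] := img_inv hs c1.
rewrite lc_mul_mono eqxx lc_mul_mono /= ei eqxx !mulr1 cats0.
exact: cong_eq.
Qed.

Lemma A_bnd k : cong Q J (A (xa n k)) [:: (1, apath Q [:: xa n k])].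
Proof.
have h : (xa n k < 2 * n)%N by rewrite ltn_pmod //; lia.
have [_ e1 _] := gamma_bnd h; have [_ e2 _] := bnd_arrow h.
by rewrite /A img_bnd // e1 -e2; apply: cong_eq.
Qed.

End Algebra.

End Triangulation.

Theorem theorem3p1 (K : numClosedFieldType) (n : nat) (T : seq (nat * nat)) :
  3 <= n -> triangulation n T ->
  let Q := QT n T in
  let J := dimer_rels K (DT n T) in
  let e := eb K (DT n T) in
  let G := Gamma n in
  let I := Gamma_rels K n in
  (exists E A : nat -> lc K,
      (forall i, i < 2 * n -> cong Q J (lc_mul Q (E i) (E i)) (E i))
   /\ (forall i j, i < 2 * n -> j < 2 * n -> i != j -> in_ideal Q J (lc_mul Q (E i) (E j)))
   /\ cong Q J (flatten [seq E i | i <- iota 0 (2 * n)]) e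
   /\ (forall a, a < size (qarr G) ->
         cong Q J (A a) (lc_mul Q (lc_mul Q (E (src G a)) (A a)) (E (tgt G a))))
   /\ (forall k, 1 <= k <= 2 * n -> cong Q J (A (xa n k)) [:: (1%R, apath Q [:: xa n k])])
   /\ (forall f : lc K, in_ideal Q J (phi G Q E A f) <-> in_ideal G I f)
   /\ (forall g : lc K, exists f : lc K, cong Q J (phi G Q E A f) (lc_mul Q (lc_mul Q e g) e)))
  /\ (forall f : lc K, cong G I (lc_mul G (t_elem K n) f) (lc_mul G f (t_elem K n))).
Proof.
move=> n3 trT; split; last exact: t_central.
(* Vertices go to trivial paths, boundary arrows to themselves and each z to its full fan. *)
exists (fun i => [:: (1%R, (i, [::]))]), (fun x => [:: (1%R, (src (Gamma n) x, img n T [:: x]))]).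
split; first by move=> i _; exact: E_idem.
split; first by move=> i j _ _; exact: E_orth.
split; first exact: E_sum.
split; first exact: A_ends.
split; first by move=> k _; exact: A_bnd.
by split; [exact: phi_ideal | exact: phi_surj].
Qed.
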